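(* Let the standing assumptions (i)–(v) and the solvability assumption of the context hold, and let $f$ be relatively strongly convex with respect to $\psi$ with constant $\mu>0$: $D_f(u,v)\ge\mu D_\psi(u,v)$ for all $u\in\operatorname{cl}\Omega$, $v\in\Omega$. Run GA-BPGsc (described in the context, with this $\mu$) and put $\mathcal U_\psi=\operatorname{cl}\Omega\cap\operatorname{dom}\Phi\cap\operatorname{dom}\psi$. After $N\ge1$ completed iterations, for every $u\in\mathcal U_\psi$, $$\Phi(y_N)-\Phi(u)\le\frac{D_\psi(u,z_0)}{\omega_1}\prod_{k=2}^N\left(1-\sqrt{\frac{2\mu\lambda_k}{\kappa_k}}\right),$$ where an empty product equals $1$. If a minimizer $x^\star\in\operatorname{cl}\Omega$ of $\Phi$ over $\operatorname{cl}\Omega$ belongs to $\operatorname{dom}\psi$, this holds with $u=x^\star$ and bounds the optimality gap $\Phi(y_N)-\Phi^\star$. In particular, in that case, a uniform bound $\sqrt{2\mu\lambda_k/\kappa_k}\ge q_{\min}>0$ for all $k$ yields linear convergence of the objective gap. Moreover, for the Burg geometry $\psi(x)=-\sum_j\log x_j$ on $\Omega=\{x\in\mathbb R^n:x_j>0\ \forall j\}$, the stated assumptions already ensure $\sup_k\kappa_k<\infty$ and linear convergence of $\Phi(y_k)-\Phi^\star$ to $0$.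
   Context: Notation. $\langle\cdot,\cdot\rangle$ and $\|\cdot\|$ are the Euclidean inner product and norm on $\mathbb R^n$. For $h:\mathbb R^n\to(-\infty,+\infty]$, $\operatorname{dom}h=\{h<+\infty\}$ and $h^*$ is the convex conjugate. A proper lower semicontinuous convex function is Legendre if it is essentially smooth and essentially strictly convex; then $\nabla h^*=(\nabla h)^{-1}$ on $\operatorname{int}\operatorname{dom}h^*$. For $v$ where $h$ is differentiable, $D_h(u,v)=h(u)-h(v)-\langle\nabla h(v),u-v\rangle$ (possibly $+\infty$ when $h(u)=+\infty$); the same notation is used for $f$. Functions given by formulas are $+\infty$ where not defined. Standing assumptions. (i) $\psi:\mathbb R^n\to(-\infty,+\infty]$ is Legendre and $\Omega=\operatorname{int}\operatorname{dom}\psi$ (nonempty open convex). (ii) $f:\mathbb R^n\to(-\infty,+\infty]$ is proper, lower semicontinuous, $\operatorname{dom}\psi\subset\operatorname{dom}f$, and $f$ is continuously differentiable on $\Omega$. (iii) $\rho:\mathbb R^n\to(-\infty,+\infty]$ is proper, lower semicontinuous, convex, with $\Omega\cap\operatorname{dom}\rho\ne\emptyset$. (iv) There is $L>0$ with $D_f(u,v)\le L D_\psi(u,v)$ for all $u,v\in\Omega$. (v) With $\Phi=f+\rho$, $\Phi^\star=\inf_{x\in\operatorname{cl}\Omega}\Phi(x)>-\infty$. BPG map. For $x\in\Omega$, $\lambda>0$, $$T_\lambda(x)=\operatorname{argmin}_{u\in\operatorname{cl}\Omega}\{\rho(u)+\langle\nabla f(x),u-x\rangle+\lambda^{-1}D_\psi(u,x)\}.$$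 Solvability assumption: $T_\lambda(x)\neq\emptyset$ for every $x\in\Omega$, $\lambda>0$ (the minimizer is then unique and lies in $\Omega$). For $\widehat y\in T_\lambda(x)$ put $g_\lambda(x)=(\nabla\psi(x)-\nabla\psi(\widehat y))/\lambda$ and $P_\lambda(x)=\lambda^{-1}[D_\psi(x,\widehat y)+D_\psi(\widehat y,x)]-D_f(\widehat y,x)$. GA-BPGsc. Inputs: $\mu>0$; $y_0\in\Omega\cap\operatorname{dom}\rho$; $\lambda_0,\kappa_0>0$; $\gamma_+\ge1$; $\gamma_-,\gamma_\kappa>1$. Set $z_0=y_0$, $\omega_0=0$, $\theta_0=1$. For $k=1,2,\dots$: if $y_{k-1}\in T_{\lambda_{k-1}}(y_{k-1})$, stop and return $y_{k-1}$. Otherwise set $\lambda=\gamma_+\lambda_{k-1}$, $\kappa=\kappa_{k-1}/\gamma_+$, write $\omega_-=\omega_{k-1}$, $\theta_-=\theta_{k-1}$, and repeat trials: (a) if $\kappa\le2\mu\lambda$, replace $\kappa$ by $\gamma_\kappa\kappa$ and restart (a); (b) $d=\kappa-2\mu\lambda$, $\alpha=[\lambda(\theta_-+\mu\omega_-)+\sqrt{\lambda^2(\theta_-+\mu\omega_-)^2+2\lambda d\,\omega_-\theta_-}]/d$, $\omega=\omega_-+\alpha$, $\theta=\theta_-+\mu\alpha$ (so $\kappa\alpha^2=2\lambda\omega\theta$), $x=(\omega_-y_{k-1}+\alpha z_{k-1})/\omega$; (c) $\widehat y\in T_\lambda(x)$; if $\widehat y=x$, stop and return $x$; (d) if $D_f(\widehat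 y,x)>\lambda^{-1}D_\psi(\widehat y,x)$, replace $\lambda$ by $\lambda/\gamma_-$ and go to (a); (e) $p=[\theta_-\nabla\psi(z_{k-1})+\mu\alpha\nabla\psi(x)-\alpha g_\lambda(x)]/\theta$; if $p\notin\operatorname{int}\operatorname{dom}\psi^*$, replace $\kappa$ by $\gamma_\kappa\kappa$ and go to (a); (f) $\widehat z=\nabla\psi^*(p)$; if $\theta D_\psi(z_{k-1},\widehat z)-\mu(\omega_-D_\psi(y_{k-1},x)+\alpha D_\psi(z_{k-1},x))>\omega P_\lambda(x)$, replace $\kappa$ by $\gamma_\kappa\kappa$ and go to (a); (g) otherwise accept: $(\alpha_k,\omega_k,\theta_k,x_k,y_k,z_k,\lambda_k,\kappa_k)=(\alpha,\omega,\theta,x,\widehat y,\widehat z,\lambda,\kappa)$. An iteration is completed when a trial is accepted; sequences are indexed by completed iterations. *)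

(* Defs.v *)
From HB Require Import structures.
From mathcomp Require Import all_boot all_order all_algebra.
From mathcomp Require Import all_classical all_reals all_analysis.

Set Implicit Arguments.
Unset Strict Implicit.
Unset Printing Implicit Defensive.

Import Order.TTheory GRing.Theory Num.Theory.
Import numFieldNormedType.Exports.

Local Open Scope classical_set_scope.
Local Open Scope ring_scope.

Section convex_analysis.
Context {R : realType} {n : nat}.
Local Notation E := 'rV[R]_n.
Implicit Types (h : E -> \bar R) (x y u v p : E).

(* The library norm on 'rV[R]_n is the sup norm, so the Euclidean structure is
   given explicitly; the topology is the same for both norms. *)
Definition dot u v : R := \sum_(i < n) u 0 i * v 0 i.
Definition enorm u : R := Num.sqrt (dot u u).

Definition dom h : set E := [set x | (h x < +oo)%E].

Definition proper_fun h : Prop := (forall x, (-oo < h x)%E) /\ dom h !=set0.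

Definition econvex h : Prop := forall x y (t : R), 0 < t -> t < 1 ->
  (h (t *: x + (1 - t) *: y)%R <= t%:E * h x + (1 - t)%:E * h y)%E.

Definition estrictly_convex_on (C : set E) h : Prop :=
  forall x y (t : R), C x -> C y -> x <> y -> 0 < t -> t < 1 ->
  (h (t *: x + (1 - t) *: y)%R < t%:E * h x + (1 - t)%:E * h y)%E.

Definition subdiff h x : set E :=
  [set v | forall y, (h x + (dot v (y - x)%R)%:E <= h y)%E].

Definition conjugate h p : \bar R :=
  ereal_sup (range (fun u => ((dot p u)%:E - h u)%E)).

Definition edifferentiable h x : Prop :=
  (\forall y \near x, h y \is a fin_num) /\ differentiable (fine \o h) x.

(* Vector representing 'd (fine \o h) x with respect to [dot]; only meaningful
   when [edifferentiable h x]. *)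
Definition grad h x : E := \row_i 'd (fine \o h) x (delta_mx 0 i).

Definition bregman h u v : \bar R :=
  (h u - h v - (dot (grad h v) (u - v)%R)%:E)%E.

(* [closure _ `\` _] is the topological boundary of the open set
   [interior (dom h)]. *)
Definition essentially_smooth h : Prop :=
  [/\ interior (dom h) !=set0,
      forall x, interior (dom h) x -> edifferentiable h x &
      forall (x_ : nat -> E) x, (forall k, interior (dom h) (x_ k)) ->
        (closure (interior (dom h)) `\` interior (dom h)) x ->
        x_ k @[k --> \oo] --> x ->
        enorm (grad h (x_ k)) @[k --> \oo] --> +oo].

Definition essentially_strictly_convex h : Prop :=
  forall C : set E, convex_set C -> C `<=` [set x | subdiff h x !=set0] ->
  estrictly_convex_on C h.

Definition legendre h : Prop :=
  [/\ proper_fun h, lower_semicontinuous h, econvex h,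
      essentially_smooth h & essentially_strictly_convex h].

Definition argmin (C : set E) h : set E :=
  [set u | C u /\ forall v, C v -> (h u <= h v)%E].

Definition burg x : \bar R :=
  if [forall j, 0 < x 0 j] then (- \sum_(j < n) ln (x 0 j))%:E else +oo%E.

End convex_analysis.

Section algorithm.
Context {R : realType} {n : nat}.
Local Notation E := 'rV[R]_n.
Variables (psi f rho : E -> \bar R).

Definition Omega : set E := interior (dom psi).

Definition Phi (x : E) : \bar R := (f x + rho x)%E.

Definition Phi_star : \bar R := ereal_inf (Phi @` closure Omega).

Definition bpg (lambda : R) (x : E) : set E :=
  argmin (closure Omega) (fun u =>
    (rho u + (dot (grad f x) (u - x)%R)%:E
     + (lambda^-1)%:E * bregman psi u x)%E).

(* [g_lambda(x)] and [P_lambda(x)], where [yh] is the point of [bpg lambda x]. *)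
Definition bpg_residual (lambda : R) (x yh : E) : E :=
  lambda^-1 *: (grad psi x - grad psi yh).

Definition bpg_P (lambda : R) (x yh : E) : \bar R :=
  ((lambda^-1)%:E * (bregman psi x yh + bregman psi yh x) - bregman f yh x)%E.

(* [alpha_k] and [x_k] play no role after iteration [k] and are not stored. *)
Record state := State {
  st_omega : R; st_theta : R; st_y : E; st_z : E; st_lambda : R; st_kappa : R }.

Definition init (y0 : E) (lambda0 kappa0 : R) : state :=
  State 0 1 y0 y0 lambda0 kappa0.

Variables (mu gplus gminus gkappa : R).

Section trial.
Variables (s : state) (lambda kappa : R).

Definition tr_d : R := kappa - 2 * mu * lambda.

Definition tr_alpha : R :=
  let b := lambda * (st_theta s + mu * st_omega s) in
  (b + Num.sqrt (b ^+ 2 + 2 * lambda * tr_d * st_omega s * st_theta s)) / tr_d.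

Definition tr_omega : R := st_omega s + tr_alpha.

Definition tr_theta : R := st_theta s + mu * tr_alpha.

Definition tr_x : E :=
  tr_omega^-1 *: (st_omega s *: st_y s + tr_alpha *: st_z s).

Definition tr_p (yh : E) : E :=
  tr_theta^-1 *: (st_theta s *: grad psi (st_z s)
    + (mu * tr_alpha) *: grad psi tr_x
    - tr_alpha *: bpg_residual lambda tr_x yh).

Definition tr_z (yh : E) : E := grad (conjugate psi) (tr_p yh).

(* [kappa] is large enough for the trial to compute [yh], and [yh] does not
   trigger the stopping test. *)
Definition tr_continues (yh : E) : Prop :=
  [/\ 2 * mu * lambda < kappa, bpg lambda tr_x yh & yh <> tr_x].

Definition tr_descent (yh : E) : Prop :=
  (bregman f yh tr_x <= (lambda^-1)%:E * bregman psi yh tr_x)%E.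

Definition tr_dual (yh : E) : Prop :=
  interior (dom (conjugate psi)) (tr_p yh).

Definition tr_gap (yh : E) : Prop :=
  (tr_theta%:E * bregman psi (st_z s) (tr_z yh)
   - mu%:E * ((st_omega s)%:E * bregman psi (st_y s) tr_x
              + tr_alpha%:E * bregman psi (st_z s) tr_x)
   <= tr_omega%:E * bpg_P lambda tr_x yh)%E.

End trial.

(* [search s lambda kappa s']: in the iteration following [s], the trials that
   begin with the pair [(lambda, kappa)] end, after finitely many rejections, by
   accepting the new state [s']. *)
Inductive search (s : state) : R -> R -> state -> Prop :=
| reject_kappa (lambda kappa : R) (s' : state) :
    kappa <= 2 * mu * lambda ->
    search s lambda (gkappa * kappa) s' -> search s lambda kappa s'
| reject_descent (lambda kappa : R) (yh : E) (s' : state) :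
    tr_continues s lambda kappa yh ->
    ~ tr_descent s lambda kappa yh ->
    search s (lambda / gminus) kappa s' -> search s lambda kappa s'
| reject_dual (lambda kappa : R) (yh : E) (s' : state) :
    tr_continues s lambda kappa yh ->
    tr_descent s lambda kappa yh -> ~ tr_dual s lambda kappa yh ->
    search s lambda (gkappa * kappa) s' -> search s lambda kappa s'
| reject_gap (lambda kappa : R) (yh : E) (s' : state) :
    tr_continues s lambda kappa yh ->
    tr_descent s lambda kappa yh -> tr_dual s lambda kappa yh ->
    ~ tr_gap s lambda kappa yh ->
    search s lambda (gkappa * kappa) s' -> search s lambda kappa s'
| accept (lambda kappa : R) (yh : E) :
    tr_continues s lambda kappa yh ->
    tr_descent s lambda kappa yh -> tr_dual s lambda kappa yh ->
    tr_gap s lambda kappa yh ->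
    search s lambda kappa
      (State (tr_omega s lambda kappa) (tr_theta s lambda kappa)
             yh (tr_z s lambda kappa yh) lambda kappa).

Definition iteration (s s' : state) : Prop :=
  ~ bpg (st_lambda s) (st_y s) (st_y s) /\
  search s (gplus * st_lambda s) (st_kappa s / gplus) s'.

(* [s 1], ..., [s N] are the results of the first [N] completed iterations of
   the algorithm started at [s 0]; the other values of [s] are irrelevant. *)
Definition run (y0 : E) (lambda0 kappa0 : R) (N : nat) (s : nat -> state) :=
  s 0%N = init y0 lambda0 kappa0 /\
  forall k, (k < N)%N -> iteration (s k) (s k.+1).

Definition rate (s : state) : R :=
  Num.sqrt (2 * mu * st_lambda s / st_kappa s).

End algorithm.

(* Convergence to 0 is R-linear: consecutive terms need not contract. *)
Definition linear_convergence {R : realType} (a : nat -> \bar R) : Prop :=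
  exists C r : R, [/\ 0 < r, r < 1 &
    forall k, (0 <= a k)%E /\ (a k <= (C * r ^+ k)%:E)%E].

(* Main.v *)
Require Import Defs.
From HB Require Import structures.
From mathcomp Require Import all_boot all_order all_algebra.
From mathcomp Require Import all_classical all_reals all_analysis.
From mathcomp Require Import ring lra.
Import Order.TTheory GRing.Theory Num.Theory.
Import numFieldNormedType.Exports.
Local Open Scope classical_set_scope.
Local Open Scope ring_scope.
Set Implicit Arguments.
Unset Strict Implicit.
Unset Printing Implicit Defensive.

(** Two arguments carry the theorem: an energy estimate for an arbitrary Legendre
    kernel, and a compactness argument for the Burg kernel.

    Energy estimate. For a comparison point [u], the quantity
    [energy u s = omega (Phi y - Phi u) + theta D_psi (u, z)] does not increase
    in a completed iteration ([accepted_energy]). The proximal step bounds [Phi]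
    from below by an affine function plus a Bregman term ([Phi_minorant]);
    evaluated at [u] and at the previous iterate with the weights of the
    extrapolation, this bound combines with the mirror step through the
    three-point identity, and the error left over is the quantity that the gap
    test controls. The initial energy is [D_psi (u, z_0)], hence
    [Phi y_N - Phi u <= D_psi (u, z_0) / omega_N]. The quadratic equation that
    defines the step gives [omega_(k-1) / omega_k <= 1 - rate] ([tr_rate]), and
    the product of these ratios is the announced bound.

    The iterates have to stay in the interior of the domain of [psi]. For the
    proximal point this is a consequence of essential smoothness: the slope of
    [psi] is unbounded when a boundary point is left towards the interior
    ([boundary_slope_unbounded], [bpg_Omega]). For the mirror point it is Legendre
    duality ([grad_conjugate]), obtained here from the growth of [h - dot p]
    around its unique minimizer.

    Burg kernel. The linear rate needs a minimizer in the open orthant. Solvability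
    of the proximal problem with step [2 / mu] makes [Phi] coercive
    ([Phi_coercive]), and lower semicontinuity yields a minimizer, in the open orthant because [f]
    is infinite on its boundary ([Phi_argmin]). The energy estimate then confines
    all iterates, and all proximal points that pass the descent test, to one
    compact box of the open orthant ([run_box], [trial_box]). There the Burg
    distance is comparable to a squared norm, so that for large [kappa] the
    quadratic cost of the mirror step is absorbed and the dual and gap tests
    succeed; this is a one-dimensional inequality in each coordinate
    ([burg_kernel_trial]). The step [lambda] stays between two positive bounds:
    the descent test succeeds when [lambda <= 1 / L], by relative smoothness, and
    fails when [lambda > 1 / mu], by relative strong convexity. So [kappa] is
    bounded ([run_kappa_le]), the rates are bounded below, and the first argument
    gives linear convergence. *)


(** * Inner product and gradients *)

Section inner_product.
Context {R : realType} {n : nat}.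
Implicit Types u v w : 'rV[R]_n.

Lemma dotC u v : dot u v = dot v u.
Proof. by apply: eq_bigr => i _; rewrite mulrC. Qed.

Lemma dotDr u v w : dot u (v + w) = dot u v + dot u w.
Proof. by rewrite -big_split; apply: eq_bigr => i _; rewrite mxE mulrDr. Qed.

Lemma dotZr a u v : dot u (a *: v) = a * dot u v.
Proof. by rewrite big_distrr; apply: eq_bigr => i _ /=; rewrite mxE; ring. Qed.

Lemma dotNr u v : dot u (- v) = - dot u v.
Proof. by rewrite -scaleN1r dotZr mulN1r. Qed.

Lemma dotBr u v w : dot u (v - w) = dot u v - dot u w.
Proof. by rewrite dotDr dotNr. Qed.

Lemma dotDl u v w : dot (u + v) w = dot u w + dot v w.
Proof. by rewrite dotC dotDr !(dotC w). Qed.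

Lemma dotZl a u v : dot (a *: u) v = a * dot u v.
Proof. by rewrite dotC dotZr dotC. Qed.

Lemma dotBl u v w : dot (u - v) w = dot u w - dot v w.
Proof. by rewrite dotC dotBr !(dotC w). Qed.

Lemma dotNl u v : dot (- u) v = - dot u v.
Proof. by rewrite dotC dotNr dotC. Qed.

Definition dotE := (dotDr, dotDl, dotNr, dotNl, dotZr, dotZl).

Lemma dot_delta u j : dot u (delta_mx 0 j) = u 0 j.
Proof.
rewrite /dot (bigD1 j)//= mxE !eqxx mulr1 big1 ?addr0// => i ij.
by rewrite mxE (negbTE ij) andbF mulr0.
Qed.

Lemma coord_le_norm u i : `|u 0 i| <= `|u|.
Proof.
by rewrite [leRHS]/Num.norm /= mx_normrE; apply: (le_bigmax _ _ (0, i)).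
Qed.

Lemma norm_le_coord u c : 0 <= c -> (forall i, `|u 0 i| <= c) -> `|u| <= c.
Proof.
move=> c0 H; rewrite /Num.norm /= mx_normrE; apply/bigmax_leP; split => //.
by move=> [i j] _; rewrite ord1.
Qed.

Lemma dot_le_norm u v : dot u v <= n%:R * (`|u| * `|v|).
Proof.
apply: (@le_trans _ _ (\sum_(i < n) (`|u| * `|v|))); last first.
  by rewrite sumr_const card_ord mulr_natl.
apply: ler_sum => i _; apply: le_trans (ler_norm _) _.
by rewrite normrM ler_pM// coord_le_norm.
Qed.

HB.instance Definition _ u :=
  GRing.isLinear.Build R 'rV[R]_n R *%R (dot u)
    (fun a x y => etrans (dotDr u (a *: x) y) (congr1 (+%R^~ _) (dotZr a u x))).

Lemma dot_continuous u : continuous (dot u).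
Proof.
apply: continuous_big => [|i _]; first exact: add_continuous.
move=> x; apply: (@continuousM _ _ (cst _) (fun v : 'rV[R]_n => v 0 i)).
  exact: cst_continuous.
exact: coord_continuous.
Qed.

End inner_product.

Section gradient.
Context {R : realType} {n : nat}.
Implicit Types (F : 'rV[R]_n -> \bar R) (v w : 'rV[R]_n).

Lemma diff_grad F v w :
  'd (fine \o F) v w = dot (grad F v) w.
Proof.
rewrite {1}(row_sum_delta w) linear_sum; apply: eq_bigr => i _ /=.
by rewrite linearZ /= mxE mulrC.
Qed.

Lemma grad_cvg F v w : edifferentiable F v ->
  t^-1 * (fine (F (v + t *: w)) - fine (F v)) @[t --> (0:R)^'+]
    --> dot (grad F v) w.
Proof.
move=> [_ dF]; rewrite -diff_grad -deriveE//.
apply: (@cvg_dnbhs_at_right R R).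
have dv : derivable (fine \o F) v w by exact: diff_derivable.
suff -> : (fun t => t^-1 * (fine (F (v + t *: w)) - fine (F v))) =
  (fun t => t^-1 *: ((fine \o F \o shift v) (t *: w) - (fine \o F) v)) by [].
by apply/funext => t /=; rewrite [t *: w + v]addrC.
Qed.

Lemma ge_dot_grad F v w c : edifferentiable F v ->
  (forall t : R, 0 < t -> t < 1 ->
     c * t <= fine (F (v + t *: w)) - fine (F v)) ->
  c <= dot (grad F v) w.
Proof.
move=> dF H; apply: (cvgr_to_ge (grad_cvg dF)).
near=> t.
rewrite mulrC ler_pdivlMr; last by near: t; exact: nbhs_right_gt.
by apply: H; near: t; [exact: nbhs_right_gt|exact: nbhs_right_lt].
Unshelve. all: by end_near. Qed.

Lemma dot_grad_le F v w c : edifferentiable F v ->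
  (forall t : R, 0 < t -> t < 1 ->
     fine (F (v + t *: w)) - fine (F v) <= c * t) ->
  dot (grad F v) w <= c.
Proof.
move=> dF H; apply: (cvgr_to_le (grad_cvg dF)).
near=> t.
rewrite mulrC ler_pdivrMr; last by near: t; exact: nbhs_right_gt.
by apply: H; near: t; [exact: nbhs_right_gt|exact: nbhs_right_lt].
Unshelve. all: by end_near. Qed.

End gradient.

(** * Convex functions and their steepness at the boundary *)

Section convex_functions.
Context {R : realType} {n : nat}.
Implicit Types (h : 'rV[R]_n -> \bar R) (a b u v w x y : 'rV[R]_n).

Lemma dom_fineK h x : proper_fun h -> dom h x -> h x = (fine (h x))%:E.
Proof. by move=> [hNy _] hx; rewrite fineK// fin_real// hNy. Qed.

Lemma dom_segment h x y t : proper_fun h -> econvex h ->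
  dom h x -> dom h y -> 0 < t -> t < 1 ->
  dom h (x + t *: (y - x)) /\
  fine (h (x + t *: (y - x))) <= fine (h x) + t * (fine (h y) - fine (h x)).
Proof.
move=> hP hC hx hy t0 t1; have := hC y x t t0 t1.
rewrite (dom_fineK hP hx) (dom_fineK hP hy) -!EFinM -EFinD => H.
have -> : x + t *: (y - x) = t *: y + (1 - t) *: x.
  by apply/rowP => i; rewrite !mxE; ring.
have hd : dom h (t *: y + (1 - t) *: x) by apply: (le_lt_trans H); exact: ltry.
split=> //; move: H; rewrite (dom_fineK hP hd) lee_fin /= => /le_trans; apply.
by lra.
Qed.

Lemma interior_dom_ball h a : interior (dom h) a ->
  exists2 r : R, 0 < r & forall e, `|e| < r -> dom h (a + e).
Proof.
move=> /nbhs_ballP[r r0 H]; exists r => // e er; apply: H.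
by rewrite -ball_normE /ball_ /= opprD addrA subrr sub0r normrN.
Qed.

Lemma interior_dom_segment h a b t : proper_fun h -> econvex h ->
  interior (dom h) a -> dom h b -> 0 < t -> t <= 1 ->
  interior (dom h) (b + t *: (a - b)).
Proof.
move=> hP hC ha hb t0; rewrite le_eqVlt => /orP[/eqP->|t1].
  by rewrite scale1r addrC subrK.
have [r r0 H] := interior_dom_ball ha.
apply/nbhs_ballP; exists (t * r) => /=; first exact: mulr_gt0.
move=> w; rewrite -ball_normE /ball_ /= => wr.
pose e := t^-1 *: (w - (b + t *: (a - b))).
have -> : w = b + t *: ((a + e) - b).
  rewrite -addrA addrCA scalerDr addrCA.
  by rewrite scalerA mulfV ?gt_eqF// scale1r subrK.
apply: (proj1 (dom_segment hP hC hb _ t0 t1)); apply: H.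
rewrite normrZ gtr0_norm ?invr_gt0// mulrC ltr_pdivrMr// -normrN opprB.
by rewrite mulrC.
Qed.

Lemma grad_ineq h u v : proper_fun h -> econvex h -> edifferentiable h v ->
  dom h v -> dom h u -> fine (h v) + dot (grad h v) (u - v) <= fine (h u).
Proof.
move=> hP hC dv hv hu; rewrite -lerBrDl.
apply: dot_grad_le => // t t0 t1.
have [_] := dom_segment hP hC hv hu t0 t1.
by rewrite mulrC; lra.
Qed.

(** A slope bounded below along a segment entering [interior (dom h)] from [b]
    bounds every partial derivative of [h] along the segment: test the gradient
    inequality against a small cross-polytope around the inner endpoint.
    Essential smoothness forbids this when [b] is a boundary point. *)
Lemma boundary_slope_unbounded h a b C : proper_fun h -> econvex h ->
  essentially_smooth h ->
  (closure (interior (dom h)) `\` interior (dom h)) b -> dom h b ->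
  interior (dom h) a ->
  ~ (forall t : R, 0 < t -> t < 1 ->
       - C * t <= fine (h (b + t *: (a - b))) - fine (h b)).
Proof.
move=> hP hC [_ hD hS] bB hb ha H.
have [r r0 hr] := interior_dom_ball ha.
pose e i (s : R) : 'rV[R]_n := (s * (r / 2)) *: delta_mx 0 i.
have he i s : `|s| = 1 -> dom h (a + e i s).
  move=> s1; apply: hr; rewrite normrZ normrM s1 mul1r gtr0_norm; last by lra.
  have : `|delta_mx 0 i : 'rV[R]_n| <= 1.
    apply: norm_le_coord => // j; rewrite mxE.
    by case: (_ && _); rewrite ?normr1 ?normr0.
  by nra.
pose m i := Num.max (fine (h (a + e i 1))) (fine (h (a + e i (-1)))).
pose M := \sum_(i < n) `|m i|.
have hM (s : R) : `|s| = 1 -> s = 1 \/ s = -1.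
  case: (lerP 0 s) => s0; first by rewrite ger0_norm//; left.
  by rewrite ltr0_norm// => s1; right; rewrite -s1 opprK.
have mM i : m i <= M.
  rewrite /M (bigD1 i)//=; apply: (le_trans (ler_norm _)).
  by rewrite lerDl sumr_ge0.
have heM i s : `|s| = 1 -> fine (h (a + e i s)) <= M.
  move=> s1; apply: le_trans (mM i); rewrite /m le_max.
  by have [->|->] := hM s s1; rewrite lexx ?orbT.
pose K := (M - fine (h b) + C) / (r / 2).
pose t k : R := (k.+2%:R)^-1.
have t0 k : 0 < t k by rewrite invr_gt0.
have t1 k : t k < 1 by rewrite invf_lt1// ltr1n.
pose x k := b + t k *: (a - b).
have hx k : interior (dom h) (x k).
  by apply: interior_dom_segment => //; rewrite ltW.
have hdx k : dom h (x k) by exact: interior_subset.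
have gK k i : `|grad h (x k) 0 i| <= K.
  have g1 s : `|s| = 1 -> s * grad h (x k) 0 i <= K.
    move=> s1.
    have := grad_ineq hP hC (hD _ (hx k)) (hdx k) (he i s s1).
    have -> : a + e i s - x k = (1 - t k) *: (a - b) + e i s.
      by apply/rowP => j; rewrite !mxE; ring.
    have := grad_ineq hP hC (hD _ (hx k)) (hdx k) hb.
    have -> : b - x k = - t k *: (a - b).
      by apply/rowP => j; rewrite !mxE; ring.
    rewrite dotDr !dotZr dot_delta => A1 A2.
    have := H _ (t0 k) (t1 k); rewrite -/(x k) => A3.
    have := heM i s s1 => A4.
    set d := dot _ _ in A1 A2; set g := grad _ _ _ _ in A2 *.
    have tk0 := t0 k; have tk1 := t1 k.
    have A5 : - C <= d by nra.
    rewrite /K ler_pdivlMr; last by lra.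
    by nra.
  by rewrite ler_norml; have := g1 1 (normr1 _); have := g1 (-1) (normrN1 _); lra.
have xb : x k @[k --> \oo] --> b.
  rewrite -[X in _ --> X]addr0; apply: cvgD; first exact: cvg_cst.
  rewrite -(scale0r (a - b)); apply: cvgZl.
  by have := @cvg_harmonic R; rewrite -(cvg_shiftS).
have /cvgryPgt := hS x b hx bB xb.
move=> /(_ (Num.sqrt (\sum_(i < n) K ^+ 2)))[N _ /(_ N (leqnn N)) /=].
apply/negP; rewrite -leNgt ler_wsqrtr//; apply: ler_sum => i _.
by rewrite -expr2 -real_normK ?num_real// lerXn2r ?nnegrE// (le_trans _ (gK N i)).
Qed.

End convex_functions.

(** * Minimization of lower semicontinuous functions *)

Section lower_semicontinuity.
Context {R : realType} {T : topologicalType}.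
Implicit Types F G : T -> \bar R.

Lemma lsc_compact_argmin (K : set T) G : compact K -> K !=set0 ->
  lower_semicontinuous G -> exists2 x, K x & forall y, K y -> (G x <= G y)%E.
Proof.
move=> cK [x0 Kx0] lG; pose m := ereal_inf (G @` K).
have mK x : K x -> (m <= G x)%E by move=> Kx; apply: ereal_inf_lbound; exists x.
have [mT|mT] := eqVneq m +oo%E.
  exists x0 => // y Ky; apply: (@le_trans _ _ +oo%E); first exact: leey.
  by rewrite -mT; exact: mK.
(* the sublevel sets of [G] above its infimum form a filter base on [K] *)
pose B (c : \bar R) := K `&` [set x | (G x < c)%E].
pose FF := filter_from [set c | (m < c)%E] B.
have FFP : ProperFilter FF.
  apply: filter_from_proper.
    apply: filter_from_filter; first by exists +oo%E; rewrite /= ltey.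
    move=> c d mc md; exists (Order.min c d); first by rewrite /= lt_min mc md.
    by move=> x [Kx]; rewrite /= lt_min => /andP[].
  by move=> c mc; have [_ [x Kx <-] xc] := ereal_inf_lt mc; exists x.
have FK : FF K by exists +oo%E; [rewrite /= ltey|move=> x []].
have [x [Kx clx]] := cK FF FFP FK.
exists x => // y Ky; apply: le_trans (mK _ Ky).
rewrite leNgt; apply/negP => mx.
have [a ma ax] : exists2 a : R, (m < a%:E)%E & (a%:E < G x)%E.
  case: m mT mx {mK B FF FFP FK clx} => [r _||_] //; case: (G x) => [s||] //.
  - rewrite lte_fin => rs; exists ((r + s) / 2); rewrite lte_fin; lra.
  - by move=> _; exists (r + 1); rewrite ?lte_fin ?ltrDl// ltry.
  - by move=> _; exists (s - 1); rewrite ?lte_fin ?ltNyr// ltrBlDr ltrDl.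
  - by move=> _; exists 0; rewrite ?ltNyr ?ltry.
have [V Vx VG] := lG _ _ ax.
have FB : FF (B a%:E) by exists a%:E.
have [z [[_ /= za] /VG]] := clx _ _ FB Vx.
by move=> /(lt_trans za); rewrite ltxx.
Qed.

Lemma lsc_add F G : (forall x, (-oo < F x)%E) -> (forall x, (-oo < G x)%E) ->
  lower_semicontinuous F -> lower_semicontinuous G ->
  lower_semicontinuous (fun x => F x + G x)%E.
Proof.
move=> FNy GNy lF lG x a ax.
have [b [c [bF cG abc]]] : exists b c : R,
    [/\ (b%:E < F x)%E, (c%:E < G x)%E & a <= b + c].
  move: (FNy x) (GNy x) ax; case: (F x) (G x) => [r||] [s||] //= _ _.
  - rewrite -EFinD lte_fin => ars.
    exists (r - (r + s - a) / 2), (s - (r + s - a) / 2).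
    by rewrite !lte_fin; split; lra.
  - move=> _; exists (r - 1), (a - r + 1).
    by rewrite lte_fin ltry; split => //; lra.
  - move=> _; exists (a - s + 1), (s - 1).
    by rewrite lte_fin ltry; split => //; lra.
  - by move=> _; exists a, 0; rewrite !ltry addr0.
have [V Vx VF] := lF _ _ bF; have [W Wx WG] := lG _ _ cG.
exists (V `&` W); first exact: filterI.
move=> y [/VF Fy /WG Gy]; apply: (@le_lt_trans _ _ (b%:E + c%:E)%E).
  by rewrite -EFinD lee_fin.
exact: lteD.
Qed.

Lemma continuous_lsc (g : T -> R) : continuous g ->
  lower_semicontinuous (EFin \o g).
Proof.
move=> cg x a; rewrite lte_fin => ax.
exists [set y | a < g y]; last by move=> y /=; rewrite lte_fin.
exact: (cvgr_gt _ (cg x)).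
Qed.

End lower_semicontinuity.

Lemma compact_box {R : realType} {n : nat} (a b : 'I_n -> R) :
  compact [set v : 'rV[R]_n | forall i, a i <= v 0 i <= b i].
Proof.
rewrite (_ : mkset _ = [set v : 'rV[R]_n | forall i, `[a i, b i]%classic (v 0 i)]).
  apply: (@rV_compact _ _ (fun i => `[a i, b i]%classic)) => i.
  exact: segment_compact.
by apply/seteqP; split => v /= H i; have := H i; rewrite in_itv.
Qed.

Lemma compact_sphere {R : realType} {n : nat} (u : 'rV[R]_n) (r : R) :
  compact [set v : 'rV[R]_n | `|v - u| = r].
Proof.
apply: bounded_closed_compact.
  exists (r + `|u|); split; first exact: num_real.
  move=> M rM v /= vr; apply: le_trans (ltW rM).
  by rewrite -vr -lerBlDr lerB_dist.
rewrite (_ : mkset _ = (fun v : 'rV[R]_n => `|v - u|) @^-1` [set r]) //.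
have cv : continuous (fun v : 'rV[R]_n => `|v - u|).
  move=> v; apply: (@continuous_comp _ _ _ (fun v : 'rV[R]_n => v - u) Num.norm).
    apply: (@continuousB _ _ _ (fun v => v) (cst u)) => //.
    exact: cst_continuous.
  exact: norm_continuous.
exact: (proj1 (continuous_closedP _) cv _ (@closed_eq R r)).
Qed.

(** * Legendre duality *)

Section legendre_duality.
Context {R : realType} {n : nat}.
Implicit Types (h : 'rV[R]_n -> \bar R) (a b p q u v w : 'rV[R]_n).

Lemma dom_closure_interior h b : proper_fun h -> econvex h ->
  interior (dom h) !=set0 -> dom h b -> closure (interior (dom h)) b.
Proof.
move=> hP hC [a ha] hb B /nbhs_ballP[e /= e0 eB].
pose t := Num.min 1 (e / (2 * (`|a - b| + 1))).
have N0 : 0 < `|a - b| + 1 by rewrite ltr_wpDl.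
have t0 : 0 < t by rewrite lt_min ltr01 divr_gt0// mulr_gt0.
exists (b + t *: (a - b)); split.
  by apply: interior_dom_segment => //; rewrite ge_min lexx.
apply: eB; rewrite -ball_normE /ball_ /= opprD addrA subrr sub0r normrN.
rewrite normrZ gtr0_norm//.
apply: (@le_lt_trans _ _ (e / (2 * (`|a - b| + 1)) * (`|a - b| + 1))).
  apply: ler_pM; rewrite ?(ltW t0)//; first by rewrite ge_min lexx orbT.
  by rewrite lerDl.
rewrite invfM mulrA -mulrA mulVf ?gt_eqF// mulr1; lra.
Qed.

Lemma grad_eq_subgradient h u p : proper_fun h -> edifferentiable h u ->
  interior (dom h) u ->
  (forall v, dom h v -> fine (h u) + dot p (v - u) <= fine (h v)) ->
  grad h u = p.
Proof.
move=> hP du hu H; have [r r0 hr] := interior_dom_ball hu.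
have S s i : `|s| = r / 2 -> s * p 0 i <= s * grad h u 0 i.
  move=> sr; rewrite -!dot_delta -!dotZr.
  apply: ge_dot_grad => // t t0 t1.
  have hd : dom h (u + t *: (s *: delta_mx 0 i)).
    apply: hr; rewrite !normrZ sr gtr0_norm//.
    have : `|delta_mx 0 i : 'rV[R]_n| <= 1.
      apply: norm_le_coord => // j; rewrite mxE.
      by case: (_ && _); rewrite ?normr1 ?normr0.
    have : 0 <= `|delta_mx 0 i : 'rV[R]_n| by [].
    set D := `|_| => D0 D1.
    have A0 : 0 <= r / 2 * D by nra.
    have A1 : r / 2 * D <= r / 2 by nra.
    by nra.
  have := H _ hd; rewrite addrAC subrr add0r [dot p (t *: _)]dotZr mulrC.
  lra.
apply/rowP => i; apply/eqP; rewrite eq_le; apply/andP; split.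
  have := S (- (r / 2)) i; rewrite normrN gtr0_norm; last by lra.
  by move=> /(_ erefl); rewrite !mulNr lerN2 ler_pM2l ?divr_gt0.
have := S (r / 2) i; rewrite gtr0_norm; last by lra.
by move=> /(_ erefl); rewrite ler_pM2l ?divr_gt0.
Qed.

Lemma conjugate_ge h p u : proper_fun h -> dom h u ->
  ((dot p u - fine (h u))%:E <= conjugate h p)%E.
Proof.
move=> hP hu; apply: ereal_sup_ubound; exists u => //.
by rewrite (dom_fineK hP hu).
Qed.

Lemma conjugate_le h p c : proper_fun h ->
  (forall u, dom h u -> dot p u - fine (h u) <= c) ->
  (conjugate h p <= c%:E)%E.
Proof.
move=> hP H; apply: ge_ereal_sup => _ [u _ <-].
have [hu|] := pselect (dom h u).
  by rewrite {1}(dom_fineK hP hu) -EFinB lee_fin H.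
by rewrite /dom /= => /negP; rewrite -leNgt leye_eq => /eqP ->; rewrite leNye.
Qed.

(** Finiteness of the conjugate at the vertices of a cross-polytope around [p]
    bounds [h - dot p] below by a multiple of the sup norm. *)
Lemma conjugate_coercive h p : proper_fun h ->
  interior (dom (conjugate h)) p ->
  exists r M : R, 0 < r /\
    forall u, dom h u -> r * `|u| - M <= fine (h u) - dot p u.
Proof.
move=> hP hp; have [r0 r00 hr] := interior_dom_ball hp.
pose r := r0 / 2; have r_gt0 : 0 < r by rewrite /r; lra.
pose c q := fine (conjugate h q).
pose q i (s : R) := p + (s * r) *: delta_mx 0 i.
pose M := `|c p| + \sum_(i < n) (`|c (q i 1)| + `|c (q i (-1))|).
exists r, M; split => // u hu.
have H w : dom (conjugate h) w -> dot w u - fine (h u) <= `|c w|.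
  move=> hw; apply: le_trans (ler_norm _); rewrite -lee_fin.
  have cu := conjugate_ge w hP hu.
  rewrite /c fineK// fin_real// hw andbT.
  by apply: lt_le_trans cu; rewrite ltNyr.
have hq i s : `|s| = 1 -> dom (conjugate h) (q i s).
  move=> s1; apply: hr; rewrite normrZ normrM s1 mul1r gtr0_norm//.
  have : `|delta_mx 0 i : 'rV[R]_n| <= 1.
    apply: norm_le_coord => // j; rewrite mxE.
    by case: (_ && _); rewrite ?normr1 ?normr0.
  by rewrite /r; nra.
have S0 : 0 <= \sum_(i < n) (`|c (q i 1)| + `|c (q i (-1))|).
  by apply: sumr_ge0 => i _; rewrite addr_ge0.
have hp0 : dom (conjugate h) p by exact: interior_subset.
rewrite lerBlDr mulrC -ler_pdivlMr//; apply: norm_le_coord => [|i].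
  apply: divr_ge0; last exact: ltW.
  by have := H _ hp0; rewrite /M; have := S0; lra.
rewrite ler_pdivlMr//.
have Si : `|c (q i 1)| + `|c (q i (-1))| <= M.
  rewrite /M (bigD1 i)//= addrCA lerDl; apply: addr_ge0 => //.
  by apply: sumr_ge0 => j _; exact: addr_ge0.
have := H _ (hq i 1 (normr1 _)); have := H _ (hq i (-1) (normrN1 _)).
have qE s : dot (q i s) u = dot p u + s * r * u 0 i.
  by rewrite /q dotDl dotZl (dotC (delta_mx _ _)) dot_delta.
rewrite !qE; have : 0 <= `|c (q i 1)| by []. have : 0 <= `|c (q i (-1))| by [].
by case: (lerP 0 (u 0 i)) => ui; [rewrite (ger0_norm ui)|rewrite (ltr0_norm ui)]; lra.
Qed.

Lemma tilted_lsc h p : proper_fun h -> lower_semicontinuous h ->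
  lower_semicontinuous (fun u => h u + (dot (- p) u)%:E)%E.
Proof.
move=> [hNy _] hl; apply: lsc_add => //; first by move=> u; rewrite ltNyr.
exact/continuous_lsc/dot_continuous.
Qed.

(** Coercivity of the tilted function [h - dot p] gives a minimizer, steepness
    keeps it off the boundary, and essential strict convexity, applied to the
    convex set of all minimizers, makes it unique. *)
Lemma tilted_argmin h p : legendre h -> interior (dom (conjugate h)) p ->
  exists u0, [/\ interior (dom h) u0, grad h u0 = p &
    forall u, dom h u -> u <> u0 ->
      fine (h u0) - dot p u0 < fine (h u) - dot p u].
Proof.
move=> [hP hl hC hS hSC] hp.
have [r [M [r0 hM]]] := conjugate_coercive hP hp.
have [v hv] := proj2 hP; have [[a ha] hD _] := hS.
pose g u := fine (h u) - dot p u.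
pose rho := (g v + M) / r.
pose K := [set u : 'rV[R]_n | forall i, - rho <= u 0 i <= rho].
have KP u : dom h u -> g u <= g v -> K u.
  move=> hu uv i; rewrite -ler_norml; apply: le_trans (coord_le_norm _ _) _.
  by rewrite /rho ler_pdivlMr//; have := hM _ hu; rewrite -/(g u) mulrC; lra.
have GE u : dom h u -> (h u + (dot (- p) u)%:E)%E = (g u)%:E.
  by move=> hu; rewrite (dom_fineK hP hu) -EFinD -scaleN1r dotZl mulN1r.
have [u0 Ku0 u0min] := @lsc_compact_argmin _ _ K _
  (@compact_box R n (fun=> - rho) (fun=> rho))
  (ex_intro _ v (KP v hv (lexx _))) (@tilted_lsc h p hP hl).
have hu0 : dom h u0.
  have := u0min v (KP v hv (lexx _)); rewrite (GE v hv) => H.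
  rewrite /dom /=; case: (h u0) H => //= r1 _; exact: ltry.
have gmin u : dom h u -> g u0 <= g u.
  move=> hu; have [uv|/ltW vu] := leP (g u) (g v).
    by have := u0min u (KP _ hu uv); rewrite !GE.
  apply: le_trans vu.
  by have := u0min v (KP v hv (lexx _)); rewrite !GE.
have u0O : interior (dom h) u0.
  apply/not_notP => nu0.
  have bu0 : (closure (interior (dom h)) `\` interior (dom h)) u0.
    by split => //; apply: dom_closure_interior => //; exists a.
  apply: (boundary_slope_unbounded (C := - dot p (a - u0)) hP hC hS bu0 hu0 ha).
  move=> t t0 t1.
  have ht : dom h (u0 + t *: (a - u0)).
    by apply: (proj1 (dom_segment hP hC hu0 (interior_subset ha) t0 t1)).
  by have := gmin _ ht; rewrite /g !dotDr !dotZr !dotDr !dotNr; lra.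
exists u0; split => //.
  apply: grad_eq_subgradient => //; first exact: hD.
  by move=> u hu; have := gmin _ hu; rewrite /g dotBr; lra.
move=> u hu uu0; rewrite -/(g u) -/(g u0) lt_neqAle gmin// andbT.
apply/eqP => gu.
pose C := [set x | dom h x /\ g x = g u0].
have CC : @convex_set R 'rV[R]_n C.
  apply/convex_setW => x y; rewrite !inE => -[hx gx] [hy gy] k k0 k1.
  have cE : conv k x y = k%:num *: x + (1 - k%:num) *: y :> 'rV[R]_n by [].
  rewrite inE cE; have := dom_segment hP hC hy hx k0 k1.
  have -> : y + k%:num *: (x - y) = k%:num *: x + (1 - k%:num) *: y.
    by apply/rowP => i; rewrite !mxE; ring.
  set z := _ + _; move=> [hz hzle]; split => //.
  apply/eqP; rewrite eq_le gmin// andbT.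
  have zE : dot p z = k%:num * dot p x + (1 - k%:num) * dot p y.
    by rewrite /z dotDr !dotZr.
  move: gx gy; rewrite /g zE => gx gy.
  have hx' : fine (h x) = dot p x + (fine (h u0) - dot p u0) by lra.
  have hy' : fine (h y) = dot p y + (fine (h u0) - dot p u0) by lra.
  by move: hzle; rewrite hx' hy'; lra.
have CS : C `<=` [set x | subdiff h x !=set0].
  move=> x [hx gx]; exists p => y; rewrite (dom_fineK hP hx).
  have [hy|] := pselect (dom h y).
    rewrite (dom_fineK hP hy) lee_fin.
    by have := gmin y hy; rewrite -gx /g dotBr; lra.
  by rewrite /dom /= => /negP; rewrite -leNgt leye_eq => /eqP ->; rewrite leey.
have t0 : 0 < 2^-1 :> R by lra.
have t1 : 2^-1 < 1 :> R by lra.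
have Cu : C u by split.
have Cu0 : C u0 by split.
have := hSC C CC CS u u0 2^-1 Cu Cu0 uu0 t0 t1.
have [hz _] := dom_segment hP hC hu0 hu t0 t1.
have -> : 2^-1 *: u + (1 - 2^-1) *: u0 = u0 + 2^-1 *: (u - u0).
  by apply/rowP => i; rewrite !mxE; ring.
rewrite (dom_fineK hP hu) (dom_fineK hP hu0) (dom_fineK hP hz).
rewrite -!EFinM -EFinD lte_fin.
have := gmin _ hz; rewrite /g dotDr dotZr dotBr.
by move: gu; rewrite /g; lra.
Qed.

(** On a small sphere around the unique minimizer the tilted function stays
    above its minimum by a positive margin; convexity propagates the margin
    outwards with linear growth. *)
Lemma tilted_growth h p u0 e : proper_fun h -> lower_semicontinuous h ->
  econvex h -> dom h u0 ->
  (forall u, dom h u -> u <> u0 ->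
      fine (h u0) - dot p u0 < fine (h u) - dot p u) ->
  0 < e -> exists2 d : R, 0 < d & forall u, dom h u -> e <= `|u - u0| ->
    fine (h u0) - dot p u0 + d * `|u - u0| <= fine (h u) - dot p u.
Proof.
move=> hP hl hC hu0 umin e0; pose g u := fine (h u) - dot p u.
have GE u : dom h u -> (h u + (dot (- p) u)%:E)%E = (g u)%:E.
  by move=> hu; rewrite (dom_fineK hP hu) -EFinD -scaleN1r dotZl mulN1r.
pose S := [set v : 'rV[R]_n | `|v - u0| = e].
have [m m0 hm] : exists2 m : R, 0 < m &
    forall u, dom h u -> S u -> g u0 + m <= g u.
  have [S0|nS] := pselect (S !=set0); last first.
    by exists 1 => // u _ Su; exfalso; apply: nS; exists u.
  have [w Sw wmin] := lsc_compact_argmin (@compact_sphere R n u0 e) S0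
    (@tilted_lsc h p hP hl).
  have wu0 : w <> u0.
    move=> wu; move: Sw; rewrite /S /= wu subrr normr0 => e00.
    by move: e0; rewrite -e00 ltxx.
  have [hw|nhw] := pselect (dom h w).
    exists (g w - g u0); first by rewrite subr_gt0; exact: umin.
    by move=> u hu Su; have := wmin u Su; rewrite !GE// lee_fin; lra.
  exists 1 => // u hu Su; exfalso; apply: nhw.
  have := wmin u Su; rewrite (GE u hu).
  by rewrite /dom /=; case: (h w) => //= r _; exact: ltry.
exists (m / e); first exact: divr_gt0.
move=> u hu eu; rewrite -/(g u) -/(g u0).
have N0 : 0 < `|u - u0| by apply: lt_le_trans eu.
move: eu; rewrite le_eqVlt => /orP[/eqP eu|eu].
  by rewrite -eu divfK ?gt_eqF//; apply: hm.
pose t := e / `|u - u0|.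
have t0 : 0 < t by exact: divr_gt0.
have t1 : t < 1 by rewrite /t ltr_pdivrMr// mul1r.
have [hz hzle] := dom_segment hP hC hu0 hu t0 t1.
have Sz : S (u0 + t *: (u - u0)).
  by rewrite /S /= addrAC subrr add0r normrZ gtr0_norm// /t divfK ?gt_eqF.
have := hm _ hz Sz; rewrite /g dotDr dotZr dotBr => H.
have H2 : m <= t * (g u - g u0) by rewrite /g; lra.
have H3 : m / t <= g u - g u0 by rewrite ler_pdivrMr// mulrC.
have -> : m / e * `|u - u0| = m / t by rewrite /t invfM invrK mulrA.
by rewrite addrC -lerBrDr.
Qed.

(** The gradient of the conjugate inverts the gradient: the minimizer [u0] of
    [h - dot p] is the derivative of [conjugate h] at [p], because by the growth
    of the tilted function the supremum defining [conjugate h q], for [q] near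
    [p], is reached up to small order at [u0]. *)
Lemma grad_conjugate h p : legendre h -> interior (dom (conjugate h)) p ->
  interior (dom h) (grad (conjugate h) p) /\
  grad h (grad (conjugate h) p) = p.
Proof.
move=> hL hp; have [u0 [u0O gu0 umin]] := tilted_argmin hL hp.
suff -> : grad (conjugate h) p = u0 by [].
have [hP hl hC hS hSC] := hL.
have hu0 : dom h u0 by exact: interior_subset.
pose c0 := dot p u0 - fine (h u0).
have close e : 0 < e -> exists2 d : R, 0 < d & forall q, `|q - p| <= d ->
    ((c0 + dot (q - p) u0)%:E <= conjugate h q <=
     (c0 + dot (q - p) u0 + e * `|q - p|)%:E)%E.
  move=> e0; pose e' := e / (n.+1)%:R.
  have e'0 : 0 < e' by rewrite divr_gt0.
  have [d d0 hd] := tilted_growth hP hl hC hu0 umin e'0.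
  exists (d / (n.+1)%:R); first by rewrite divr_gt0.
  move=> q; rewrite ler_pdivlMr// => qd; apply/andP; split.
    apply: le_trans (conjugate_ge q hP hu0).
    by rewrite lee_fin /c0 dotBl; lra.
  apply: conjugate_le => // u hu.
  have -> : dot q u = dot p u + dot (q - p) u0 + dot (q - p) (u - u0).
    by rewrite !dotE; ring.
  have n1 : n%:R <= n.+1%:R :> R by rewrite ler_nat.
  have D := dot_le_norm (q - p) (u - u0).
  have N1 : 0 <= `|q - p| by []. have N2 : 0 <= `|u - u0| by [].
  have D2 : dot (q - p) (u - u0) <= n.+1%:R * (`|q - p| * `|u - u0|).
    by apply: le_trans D _; apply: ler_wpM2r => //; exact: mulr_ge0.
  have [eu|ue] := leP e' `|u - u0|.
    have := hd u hu eu; rewrite /c0.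
    have : n.+1%:R * (`|q - p| * `|u - u0|) <= d * `|u - u0|.
      by rewrite mulrA; apply: ler_wpM2r => //; rewrite mulrC.
    by have := mulr_ge0 (ltW e0) N1; lra.
  have : n.+1%:R * (`|q - p| * `|u - u0|) <= e * `|q - p|.
    rewrite mulrCA mulrC; apply: ler_wpM2r => //.
    by rewrite -(@divfK _ n.+1%:R _ e) ?pnatr_eq0// mulrC ler_wpM2r// ltW.
  have : dot p u - fine (h u) <= c0.
    have [->//|/eqP uu] := eqVneq u u0.
    by have := umin u hu uu; rewrite /c0; lra.
  by move: D2; lra.
have fp : fine (conjugate h p) = c0.
  have [d d0 /(_ p)] := close 1 ltr01.
  rewrite subrr normr0 (ltW d0) => /(_ isT).
  have -> : dot 0 u0 = 0 by rewrite -(scale0r (0 : 'rV[R]_n)) dotZl mul0r.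
  by rewrite mulr0 !addr0 => /le_anti <-.
have dE : 'd (fine \o conjugate h) p = dot u0 :> ('rV[R]_n -> R).
  apply: (@diff_unique _ _ _ _ (dot u0 : {linear 'rV[R]_n -> R})).
    exact: dot_continuous.
  apply/eqaddoP => e e0.
  have [d d0 hd] := close e e0.
  apply/nbhs_ballP; exists d => //= w.
  rewrite -ball_normE /ball_ /= sub0r normrN => wd.
  have := hd (w + p); rewrite addrK (ltW wd) => /(_ isT).
  rewrite /= !fctE /= fp => /andP[A B].
  have : conjugate h (w + p) \is a fin_num.
    by rewrite fin_real// (lt_le_trans _ A) ?ltNyr// (le_lt_trans B) ?ltry.
  move=> /fineK fE; move: A B; rewrite -fE !lee_fin (dotC w) => A B.
  by rewrite ler_norml; apply/andP; split; have := mulr_ge0 (ltW e0) (normr_ge0 w); lra.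
by apply/rowP => i; rewrite mxE dE dot_delta.
Qed.

End legendre_duality.

(** * One accepted trial decreases the energy *)

(* The computations below hold for arbitrary vectors in place of the gradients;
   abstracting them avoids unfolding the differential when terms are compared. *)
Ltac abstract_grad := repeat match goal with
  | |- context [@grad ?R ?n ?h ?v] =>
      let g := fresh "g" in set (g := @grad R n h v) in *; clearbody g
  | H : context [@grad ?R ?n ?h ?v] |- _ =>
      let g := fresh "g" in set (g := @grad R n h v) in *; clearbody g
  end.

(** The real value of [bregman h u v] when [h u] and [h v] are finite. *)
Definition rbregman {R : realType} {n : nat} (h : 'rV[R]_n -> \bar R)
    (u v : 'rV[R]_n) : R :=
  fine (h u) - fine (h v) - dot (grad h v) (u - v).

Ltac abstract_scalars := repeat match goal with
  | |- context [@rbregman ?R ?n ?h ?u ?v] =>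
      generalize (@rbregman R n h u v); intro
  | |- context [@dot ?R ?n ?u ?v] => generalize (@dot R n u v); intro
  end.

Section bregman_distance.
Context {R : realType} {n : nat}.
Implicit Types (h : 'rV[R]_n -> \bar R) (u v w : 'rV[R]_n).

Lemma bregmanE h u v : proper_fun h -> dom h u -> dom h v ->
  bregman h u v = (rbregman h u v)%:E.
Proof.
move=> hP hu hv; rewrite /bregman (dom_fineK hP hu) (dom_fineK hP hv).
by rewrite -!EFinB.
Qed.

Lemma rbregman_ge0 h u v : proper_fun h -> econvex h -> edifferentiable h v ->
  dom h v -> dom h u -> 0 <= rbregman h u v.
Proof.
by move=> hP hC dv hv hu; have := grad_ineq hP hC dv hv hu; rewrite /rbregman; lra.
Qed.

Lemma rbregman_three_point h u v w :
  rbregman h u w = rbregman h u v + rbregman h v w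
    + dot (grad h v - grad h w) (u - v).
Proof. by rewrite /rbregman; abstract_grad; rewrite !dotE; ring. Qed.

Lemma rbregman_sym h u v :
  rbregman h u v + rbregman h v u = dot (grad h u - grad h v) (u - v).
Proof. by rewrite /rbregman; abstract_grad; rewrite !dotE; ring. Qed.

End bregman_distance.

Section accepted_trial.
Context {R : realType} {n : nat} (psi f rho : 'rV[R]_n -> \bar R) (mu : R)
  (psi_legendre : legendre psi) (f_proper : proper_fun f)
  (dom_psi_f : dom psi `<=` dom f) (rho_proper : proper_fun rho)
  (rho_convex : econvex rho)
  (Omega_dom_rho : (Omega psi `&` dom rho) !=set0) (mu_gt0 : 0 < mu)
  (f_strong : forall u v : 'rV[R]_n, closure (Omega psi) u -> Omega psi v ->
      (mu%:E * bregman psi u v <= bregman f u v)%E).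
Implicit Types (u v x yh : 'rV[R]_n) (s : @state R n).

Local Notation D := (rbregman psi).

Let psiP : proper_fun psi. Proof. by case: psi_legendre. Qed.
Let psiC : econvex psi. Proof. by case: psi_legendre. Qed.
Let psiS : essentially_smooth psi. Proof. by case: psi_legendre. Qed.
Let psiD x : Omega psi x -> edifferentiable psi x.
Proof. by case: psiS => _ + _; apply. Qed.

Lemma Omega_dom x : Omega psi x -> dom psi x.
Proof. exact: interior_subset. Qed.

Lemma dom_closure_Omega x : dom psi x -> closure (Omega psi) x.
Proof. by apply: dom_closure_interior => //; case: psiS. Qed.

Lemma D_ge0 u v : dom psi u -> Omega psi v -> 0 <= D u v.
Proof.
by move=> hu hv; apply: rbregman_ge0 => //; [exact: psiD|exact: Omega_dom].
Qed.

Lemma real_strong u v : dom psi u -> Omega psi v ->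
  mu * D u v <= rbregman f u v.
Proof.
move=> hu hv; have := f_strong (dom_closure_Omega hu) hv.
have hv' := Omega_dom hv.
by rewrite (bregmanE psiP hu hv') (bregmanE f_proper) ?lee_fin//; exact: dom_psi_f.
Qed.

Section prox.
Variables (lambda : R) (x : 'rV[R]_n).
Hypotheses (lambda_gt0 : 0 < lambda) (xO : Omega psi x).

Let model u := (rho u + (dot (grad f x) (u - x))%:E
     + (lambda^-1)%:E * bregman psi u x)%E.
Let rmodel u := fine (rho u) + dot (grad f x) (u - x) + lambda^-1 * D u x.

Let modelE u : dom psi u -> dom rho u -> model u = (rmodel u)%:E.
Proof.
move=> hu ru; rewrite /model (dom_fineK rho_proper ru).
by rewrite (bregmanE psiP hu (Omega_dom xO)) -EFinM -!EFinD.
Qed.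

Let model_dom u : (model u < +oo)%E -> dom psi u /\ dom rho u.
Proof.
have [psiNy _] := psiP; have [rhoNy _] := rho_proper.
have px := dom_fineK psiP (Omega_dom xO).
have := psiNy u; have := rhoNy u.
have l0 : (0 < (lambda^-1)%:E)%E by rewrite lte_fin invr_gt0.
rewrite /model /bregman /dom /= px.
case: (psi u) => [a||]; case: (rho u) => [b||] //= _ _; rewrite ?ltry//.
- by rewrite gt0_muley.
- by rewrite gt0_muley.
Qed.

(** The proximal minimizer is interior because the model decreases at an
    infinite rate when a boundary point is left towards a point of
    [Omega psi] where [rho] is finite. *)
Lemma bpg_Omega yh : bpg psi f rho lambda x yh ->
  Omega psi yh /\ dom rho yh.
Proof.
move=> [yc ymin]; have [v [vO vr]] := Omega_dom_rho.
have vd := Omega_dom vO.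
have [yd yr] : dom psi yh /\ dom rho yh.
  apply: model_dom; apply: (@le_lt_trans _ _ (model v)).
    exact/ymin/dom_closure_Omega.
  by rewrite modelE// ltry.
split => //; apply/not_notP => nyO.
pose w := v - yh; pose l := lambda^-1.
have l0 : 0 < l by rewrite invr_gt0.
pose C := lambda * (fine (rho v) - fine (rho yh) + dot (grad f x) w
  - l * dot (grad psi x) w).
have yB : (closure (Omega psi) `\` Omega psi) yh by [].
apply: (boundary_slope_unbounded (C := C) psiP psiC psiS yB yd vO) => t t0 t1.
have zO : Omega psi (yh + t *: w).
  by apply: interior_dom_segment => //; exact: ltW.
have zd := Omega_dom zO.
have [zr rz] := dom_segment rho_proper rho_convex yr vr t0 t1.
have := ymin _ (dom_closure_Omega zd).
rewrite -/(model _) -/(model _) !modelE// lee_fin /rmodel /rbregman -/l -/w.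
have -> : yh + t *: w - x = (yh - x) + t *: w by rewrite addrAC.
rewrite /C; move: (grad f x) (grad psi x) => gf gp.
rewrite !(dotDr _ (yh - x)) !dotZr => A.
rewrite -(ler_pM2l l0) mulNr mulrN !mulrA /l mulVf ?gt_eqF// mul1r -/l.
by move: A rz; rewrite -/w; lra.
Qed.

Lemma bpg_le yh u : bpg psi f rho lambda x yh -> dom psi u -> dom rho u ->
  fine (rho yh) + dot (grad f x) (yh - x) + lambda^-1 * D yh x
  <= fine (rho u) + dot (grad f x) (u - x) + lambda^-1 * D u x.
Proof.
move=> yB ud ur; have [yO yr] := bpg_Omega yB.
rewrite -lee_fin -/(rmodel yh) -/(rmodel u) -!modelE//; last exact: Omega_dom.
by apply: (proj2 yB); exact: dom_closure_Omega.
Qed.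

(** The minimizer is compared with nearby points of the segment to [u]: there
    [rho] is bounded by convexity, and [psi], differentiable at the interior
    point [yh], is linear to first order. *)
Lemma bpg_optimality yh u : bpg psi f rho lambda x yh ->
  dom psi u -> dom rho u ->
  fine (rho yh) + dot (bpg_residual psi lambda x yh - grad f x) (u - yh)
    <= fine (rho u).
Proof.
move=> yB ud ur; have [yO yr] := bpg_Omega yB.
have [yc ymin] := yB; have yd := Omega_dom yO.
pose w := u - yh; pose l := lambda^-1.
have l0 : 0 < l by rewrite invr_gt0.
pose c := lambda * (fine (rho yh) - fine (rho u) - dot (grad f x) w
  + l * dot (grad psi x) w).
have : c <= dot (grad psi yh) w.
  apply: ge_dot_grad; first exact: psiD.
  move=> t t0 t1.
  have [zd _] := dom_segment psiP psiC yd ud t0 t1.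
  have [zr rz] := dom_segment rho_proper rho_convex yr ur t0 t1.
  have := ymin _ (dom_closure_Omega zd).
  rewrite -/(model _) -/(model _) !modelE// lee_fin /rmodel /rbregman -/l -/w.
  have -> : yh + t *: w - x = (yh - x) + t *: w by rewrite addrAC.
  rewrite /c; move: (grad f x) (grad psi x) => gf gp.
  rewrite !(dotDr _ (yh - x)) !dotZr => A.
  rewrite -(ler_pM2l l0) !mulrA /l mulVf ?gt_eqF// mul1r -/l.
  by move: A rz; rewrite -/w; lra.
rewrite /c mulrC -ler_pdivlMr// -/l -/w /bpg_residual -/l.
move: (grad f x) (grad psi x) (grad psi yh) => gf gp gy.
by rewrite !dotE; lra.
Qed.

Definition real_P yh := lambda^-1 * (D x yh + D yh x) - rbregman f yh x.

Lemma bpg_PE yh : Omega psi yh -> bpg_P psi f lambda x yh = (real_P yh)%:E.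
Proof.
move=> yO; have yd := Omega_dom yO; have xd := Omega_dom xO.
rewrite /bpg_P !(bregmanE psiP)// (bregmanE f_proper) ?dom_psi_f//; last first.
  by apply: dom_psi_f.
by apply: dom_psi_f.
Qed.

(** The minorant of [Phi] supplied by one proximal step: convexity of [rho] at
    the minimizer, relative strong convexity of [f] at [x]. *)
Lemma Phi_minorant yh v : bpg psi f rho lambda x yh ->
  dom psi v -> dom rho v ->
  fine (f yh) + fine (rho yh) + real_P yh
    + dot (bpg_residual psi lambda x yh) (v - x) + mu * D v x
  <= fine (f v) + fine (rho v).
Proof.
move=> yB vd vr; have := bpg_optimality yB vd vr.
have := real_strong vd xO.
have E : lambda^-1 * (D x yh + D yh x)
    = dot (bpg_residual psi lambda x yh) (x - yh).
  by rewrite rbregman_sym /bpg_residual dotZl.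
rewrite /real_P E; set g := bpg_residual _ _ _ _.
rewrite /rbregman; move: (grad f x) g => gf g.
by rewrite !dotE; lra.
Qed.

End prox.

Definition feasible s := [/\ Omega psi (st_y s), dom rho (st_y s),
  Omega psi (st_z s), 0 <= st_omega s & st_theta s = 1 + mu * st_omega s].

Definition rPhi u := fine (f u) + fine (rho u).

(** The Lyapunov function of the accelerated scheme. *)
Definition energy u s :=
  st_omega s * (rPhi (st_y s) - rPhi u) + st_theta s * D u (st_z s).

Section trial.
Variables (s : @state R n) (lambda kappa : R).
Hypotheses (sF : feasible s) (lambda_gt0 : 0 < lambda)
  (kappa_gt : 2 * mu * lambda < kappa).

Local Notation alpha := (tr_alpha mu s lambda kappa).
Local Notation omega := (tr_omega mu s lambda kappa).
Local Notation theta := (tr_theta mu s lambda kappa).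
Local Notation x := (tr_x mu s lambda kappa).

Let w0 : 0 <= st_omega s. Proof. by case: sF. Qed.
Let th1 : 1 <= st_theta s.
Proof. by have [_ _ _ w ->] := sF; rewrite lerDl mulr_ge0// ltW. Qed.

Lemma tr_d_gt0 : 0 < tr_d mu lambda kappa.
Proof. by rewrite /tr_d subr_gt0. Qed.

Lemma tr_alpha_gt0 : 0 < alpha.
Proof.
rewrite /tr_alpha divr_gt0// ?tr_d_gt0// ltr_pwDl ?sqrtr_ge0//.
apply: mulr_gt0 => //; apply: ltr_pwDl; first exact: lt_le_trans ltr01 th1.
by rewrite mulr_ge0// ltW.
Qed.

Lemma tr_omega_gt0 : 0 < omega.
Proof. by rewrite /tr_omega ltr_wpDl// tr_alpha_gt0. Qed.

Lemma tr_thetaE : theta = 1 + mu * omega.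
Proof. by have [_ _ _ _ E] := sF; rewrite /tr_theta /tr_omega E; ring. Qed.

Lemma tr_theta_gt0 : 0 < theta.
Proof. by rewrite tr_thetaE ltr_pwDl// mulr_ge0// ltW// tr_omega_gt0. Qed.

(** [tr_alpha] is the positive root of this quadratic equation. *)
Lemma tr_alpha_eq : kappa * alpha ^+ 2 = 2 * lambda * omega * theta.
Proof.
have d0 := tr_d_gt0.
set d := tr_d mu lambda kappa in d0.
have kd : kappa = d + 2 * mu * lambda by rewrite /d /tr_d; ring.
rewrite /tr_omega /tr_theta; set a := alpha.
set b := lambda * (st_theta s + mu * st_omega s).
pose q := b ^+ 2 + 2 * lambda * d * st_omega s * st_theta s.
have q0 : 0 <= q.
  rewrite /q addr_ge0 ?sqr_ge0// !mulr_ge0 ?(ltW d0) ?(ltW lambda_gt0)//.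
  exact: le_trans ler01 th1.
have aE : a * d - b = Num.sqrt q.
  by rewrite /a /tr_alpha -/b -/d -/q divfK ?gt_eqF// addrC addKr.
have : (a * d - b) ^+ 2 = q by rewrite aE sqr_sqrtr.
rewrite /q kd => E.
have E2 : d * (d * a ^+ 2 - 2 * a * b - 2 * lambda * st_omega s * st_theta s) = 0.
  by move: E; lra.
move/eqP: E2; rewrite mulf_eq0 gt_eqF//= => /eqP.
by rewrite /b; lra.
Qed.

(** Since [theta >= mu * omega], the quadratic equation bounds the relative
    step [alpha / omega] below by the rate of the accepted state. *)
Lemma tr_rate : Num.sqrt (2 * mu * lambda / kappa) <= 1 - st_omega s / omega.
Proof.
have wp := tr_omega_gt0; have ap := tr_alpha_gt0.
have kp : 0 < kappa.
  by apply: le_lt_trans kappa_gt; rewrite !mulr_ge0// ltW.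
have -> : 1 - st_omega s / omega = alpha / omega.
  by rewrite -{1}(@divff _ omega) ?gt_eqF// -mulrBl /tr_omega addrAC subrr add0r.
have r0 : 0 <= alpha / omega by rewrite ltW// divr_gt0.
rewrite -[leRHS](ger0_norm r0) -sqrtr_sqr ler_wsqrtr//.
rewrite expr_div_n ler_pdivlMr ?exprn_gt0// mulrAC ler_pdivrMr// [leRHS]mulrC.
rewrite tr_alpha_eq tr_thetaE expr2 !mulrA -!mulrA.
have : 0 <= lambda * omega by rewrite ltW// mulr_gt0.
by lra.
Qed.

Lemma tr_x_Omega : Omega psi x.
Proof.
have [yO _ zO _ _] := sF; have wp := tr_omega_gt0; have ap := tr_alpha_gt0.
have -> : x = st_y s + (alpha / omega) *: (st_z s - st_y s).
  apply/rowP => i; rewrite !mxE.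
  have E : st_omega s = omega - alpha by rewrite /tr_omega addrK.
  by rewrite {1}E; field; rewrite gt_eqF.
apply: interior_dom_segment => //; first exact: Omega_dom.
  by rewrite divr_gt0.
by rewrite ler_pdivrMr// mul1r /tr_omega lerDr.
Qed.

Variable yh : 'rV[R]_n.
Hypothesis yB : bpg psi f rho lambda x yh.
Local Notation zh := (tr_z psi mu s lambda kappa yh).
Local Notation g := (bpg_residual psi lambda x yh).

Lemma tr_y_Omega : Omega psi yh /\ dom rho yh.
Proof. exact: bpg_Omega lambda_gt0 tr_x_Omega _ yB. Qed.

Lemma tr_z_dual : tr_dual psi mu s lambda kappa yh ->
  Omega psi zh /\ grad psi zh = tr_p psi mu s lambda kappa yh.
Proof. by move=> H; exact: grad_conjugate. Qed.

Lemma tr_gapE : Omega psi zh ->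
  tr_gap psi f mu s lambda kappa yh <->
  theta * D (st_z s) zh
    - mu * (st_omega s * D (st_y s) x + alpha * D (st_z s) x)
  <= omega * real_P lambda x yh.
Proof.
move=> zhO; have [yO _ zO _ _] := sF; have xO := tr_x_Omega.
have [yhO _] := tr_y_Omega.
rewrite /tr_gap (bpg_PE lambda xO yhO) (bregmanE psiP (Omega_dom zO) (Omega_dom zhO))
  (bregmanE psiP (Omega_dom yO) (Omega_dom xO))
  (bregmanE psiP (Omega_dom zO) (Omega_dom xO)).
by rewrite -!EFinM -!EFinD lee_fin.
Qed.

(** Weighting [Phi_minorant] at the old iterate by [omega] and at the
    comparison point by [alpha], the linear terms combine with the mirror step
    through the three-point identity; what remains is the gap test. *)
Lemma accepted_energy u : tr_dual psi mu s lambda kappa yh ->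
  tr_gap psi f mu s lambda kappa yh -> dom psi u -> dom rho u ->
  let s' := State omega theta yh zh lambda kappa in
  feasible s' /\ energy u s' <= energy u s.
Proof.
move=> hd hg ud ur /=; have [yhO yhr] := tr_y_Omega.
have [zhO zhE] := tr_z_dual hd; have xO := tr_x_Omega.
have [yO yr zO _ thE] := sF; have wp := tr_omega_gt0; have ap := tr_alpha_gt0.
split; first by split => //=; [exact: ltW|exact: tr_thetaE].
move/(tr_gapE zhO): hg => hg.
have My := Phi_minorant lambda_gt0 xO yB (Omega_dom yO) yr.
have Mu := Phi_minorant lambda_gt0 xO yB ud ur.
have {}My := ler_wpM2l w0 My; have {}Mu := ler_wpM2l (ltW ap) Mu.
have Gx : st_omega s * dot g (st_y s - x) + alpha * dot g (u - x)
    = alpha * dot g (u - st_z s).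
  have xE : omega * dot g x = st_omega s * dot g (st_y s) + alpha * dot g (st_z s).
    by rewrite -dotZr /tr_x scalerA mulfV ?gt_eqF// scale1r dotDr !dotZr.
  by move: xE; rewrite !dotBr {1}/tr_omega; lra.
have Z := rbregman_three_point psi u (st_z s) zh.
have X := rbregman_three_point psi u (st_z s) x.
have pE : theta * dot (grad psi (st_z s) - grad psi zh) (u - st_z s)
    = mu * alpha * dot (grad psi (st_z s) - grad psi x) (u - st_z s)
      + alpha * dot g (u - st_z s).
  rewrite zhE /tr_p -!dotZl -dotDl; congr (dot _ _).
  rewrite scalerBr scalerA mulfV ?gt_eqF ?tr_theta_gt0// scale1r.
  rewrite /tr_theta.
  move: (grad psi (st_z s)) (grad psi x) (bpg_residual _ _ _ _) => gz gx gr.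
  by move: alpha => a; apply/rowP => i; rewrite !mxE; ring.
have tE : theta = st_theta s + mu * alpha by [].
have oE : omega = st_omega s + alpha by [].
rewrite /energy /= /rPhi Z tE oE; move: X pE Gx hg My Mu; rewrite tE oE.
move: (real_P _ _ _) (tr_alpha _ _ _ _) => P a; abstract_scalars.
move=> -> pE Gx hg My Mu.
by move: pE Gx hg My Mu; lra.
Qed.

End trial.

End accepted_trial.

(** * The convergence estimate *)

Section convergence.
Context {R : realType} {n : nat} (psi f rho : 'rV[R]_n -> \bar R)
  (mu gplus gminus gkappa lambda0 kappa0 : R) (y0 : 'rV[R]_n)
  (psi_legendre : legendre psi) (f_proper : proper_fun f)
  (dom_psi_f : dom psi `<=` dom f) (rho_proper : proper_fun rho)
  (rho_convex : econvex rho)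
  (Omega_dom_rho : (Omega psi `&` dom rho) !=set0) (mu_gt0 : 0 < mu)
  (f_strong : forall u v : 'rV[R]_n, closure (Omega psi) u -> Omega psi v ->
      (mu%:E * bregman psi u v <= bregman f u v)%E)
  (y0_in : (Omega psi `&` dom rho) y0) (lambda0_gt0 : 0 < lambda0)
  (gplus_ge1 : 1 <= gplus) (gminus_gt1 : 1 < gminus).
Implicit Types (u v : 'rV[R]_n) (s : nat -> @state R n).

Local Notation D := (rbregman psi).
Local Notation feasible := (feasible psi rho mu).
Local Notation rPhi := (rPhi f rho).
Local Notation energy := (energy psi f rho).
Local Notation search := (search psi f rho mu gminus gkappa).
Local Notation iteration := (iteration psi f rho mu gplus gminus gkappa).
Local Notation is_run := (run psi f rho mu gplus gminus gkappa y0 lambda0 kappa0).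

Lemma search_accepts (s s' : @state R n) (lambda kappa : R) : 0 < lambda ->
  search s lambda kappa s' -> exists l k yh,
    [/\ 0 < l, tr_continues psi f rho mu s l k yh,
        tr_dual psi mu s l k yh, tr_gap psi f mu s l k yh &
        s' = State (tr_omega mu s l k) (tr_theta mu s l k) yh
               (tr_z psi mu s l k yh) l k].
Proof.
move=> + S; elim: S => {lambda kappa s'}.
- by move=> lambda kappa s' _ _ IH /IH.
- move=> lambda kappa yh s' _ _ _ IH l0; apply: IH.
  by rewrite divr_gt0// (lt_trans ltr01).
- by move=> lambda kappa yh s' _ _ _ _ IH /IH.
- by move=> lambda kappa yh s' _ _ _ _ _ IH /IH.
- by move=> lambda kappa yh c _ d g l0; exists lambda, kappa, yh.
Qed.

Lemma iteration_step (s s' : @state R n) : feasible s -> 0 < st_lambda s -> iteration s s' ->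
  [/\ feasible s', 0 < st_lambda s', 2 * mu * st_lambda s' < st_kappa s',
      0 < st_omega s' /\ rate mu s' <= 1 - st_omega s / st_omega s' &
      forall u, dom psi u -> dom rho u -> energy u s' <= energy u s].
Proof.
move=> sF l0 [_ /search_accepts[|l [k [yh [lp [kp yB _] dual gap ->]]]]].
  by rewrite mulr_gt0// (lt_le_trans ltr01).
have A u (ud : dom psi u) (ur : dom rho u) := accepted_energy psi_legendre
  f_proper dom_psi_f rho_proper rho_convex Omega_dom_rho mu_gt0 f_strong
  sF lp kp yB dual gap ud ur.
have [v [vO vr]] := Omega_dom_rho.
split => //=.
- by have [] := A v (Omega_dom vO) vr.
- split; first exact: (tr_omega_gt0 mu_gt0 sF lp kp).
  exact: (tr_rate mu_gt0 sF lp kp).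
- by move=> u ud ur; have [] := A u ud ur.
Qed.

Lemma run_invariant N s : is_run N s -> forall k, (k <= N)%N ->
  [/\ feasible (s k), 0 < st_lambda (s k) &
      forall u, dom psi u -> dom rho u -> energy u (s k) <= D u y0].
Proof.
move=> [s0 sS]; elim=> [_|k IH kN].
  rewrite s0 /=; have [yO yr] := y0_in; split => //.
    by split => //=; rewrite mulr0 addr0.
  by move=> u ud ur; rewrite /energy /= mul0r add0r mul1r.
have [F l E] := IH (ltnW kN).
have [F' l' _ _ E'] := iteration_step F l (sS k kN).
by split => // u ud ur; apply: le_trans (E' _ ud ur) (E _ ud ur).
Qed.

Lemma run_step N s k : is_run N s -> (k < N)%N ->
  [/\ 2 * mu * st_lambda (s k.+1) < st_kappa (s k.+1),
      0 < st_omega (s k.+1) &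
      rate mu (s k.+1) <= 1 - st_omega (s k) / st_omega (s k.+1)].
Proof.
move=> sR kN; have [F l _] := run_invariant sR (ltnW kN).
by have [_ _ kp [wp r] _] := iteration_step F l (proj2 sR k kN).
Qed.

Lemma rate_lt1 N s k : is_run N s -> (k < N)%N -> rate mu (s k.+1) < 1.
Proof.
move=> sR kN; have [kp _ _] := run_step sR kN.
have [_ l _] := run_invariant sR kN.
have ml : 0 < 2 * mu * st_lambda (s k.+1) by rewrite !mulr_gt0.
rewrite /rate -[ltRHS]sqrtr1 ltr_sqrt// ltr_pdivrMr ?mul1r//.
exact: lt_trans kp.
Qed.

(** The weights telescope: [1 / omega_N] is [1 / omega_1] times the successive
    ratios [omega_(k-1) / omega_k]. *)
Lemma inv_omega_le N s : is_run N.+1 s ->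
  (st_omega (s N.+1))^-1 <=
  (st_omega (s 1%N))^-1 * \prod_(2 <= k < N.+2) (1 - rate mu (s k)).
Proof.
move=> sR; have : (N < N.+1)%N by [].
elim: {1 3 4}N => [_|m IH mN]; first by rewrite big_geq// mulr1.
have {}IH := IH (ltnW mN).
have [_ w1 _] := run_step sR (ltnW mN).
have [_ w2 r] := run_step sR mN.
rewrite big_nat_recr//= mulrA.
apply: (@le_trans _ _ ((st_omega (s m.+1))^-1 * (1 - rate mu (s m.+2)))).
  by rewrite ler_pdivlMl//; lra.
apply: ler_wpM2r => //.
by rewrite subr_ge0 ltW// (rate_lt1 sR mN).
Qed.

Definition rbound s N : R :=
  (st_omega (s 1%N))^-1 * \prod_(2 <= k < N.+1) (1 - rate mu (s k)).

Theorem real_estimate N s u : (1 <= N)%N -> is_run N s ->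
  dom psi u -> dom rho u ->
  rPhi (st_y (s N)) - rPhi u <= D u y0 * rbound s N.
Proof.
case: N => // N _ sR ud ur.
have [[yO yr zO w0 thE] l E] := run_invariant sR (leqnn _).
have [_ wp _] := run_step sR (ltnSn N).
have D0 : 0 <= D u y0.
  by have [y0O _] := y0_in; apply: D_ge0.
apply: (@le_trans _ _ (D u y0 * (st_omega (s N.+1))^-1)); last first.
  by apply: ler_wpM2l => //; exact: inv_omega_le.
rewrite ler_pdivlMr// mulrC; apply: le_trans (E _ ud ur).
rewrite /energy lerDl mulr_ge0//; last exact: D_ge0.
by rewrite thE addr_ge0// mulr_ge0// ltW.
Qed.

Lemma PhiE v : dom psi v -> dom rho v -> Phi f rho v = (rPhi v)%:E.
Proof.
move=> vd vr; rewrite /Phi (dom_fineK f_proper (dom_psi_f vd)).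
by rewrite (dom_fineK rho_proper vr) -EFinD.
Qed.

Lemma dom_Phi_rho u : dom (Phi f rho) u -> dom rho u.
Proof.
rewrite /dom /Phi /=; have [fNy _] := f_proper; have [rNy _] := rho_proper.
by have := fNy u; have := rNy u; case: (f u); case: (rho u).
Qed.

Lemma run_y N s k : is_run N s -> (k <= N)%N ->
  dom psi (st_y (s k)) /\ dom rho (st_y (s k)).
Proof.
by move=> sR kN; have [[yO yr _ _ _] _ _] := run_invariant sR kN; split => //; exact: Omega_dom.
Qed.

Lemma estimate N s u : (1 <= N)%N -> is_run N s ->
  dom psi u -> dom rho u ->
  (Phi f rho (st_y (s N)) - Phi f rho u <=
   bregman psi u (st_z (s 0%N)) * (rbound s N)%:E)%E.
Proof.
move=> N1 sR ud ur; have [yd yr] := run_y sR (leqnn _).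
have [s0 _] := sR; have [y0O _] := y0_in.
have psiP : proper_fun psi by case: psi_legendre.
rewrite s0 /= (bregmanE psiP ud (Omega_dom y0O)) !PhiE// -EFinM -EFinB lee_fin.
exact: real_estimate.
Qed.

Section minimizer.
Variable xstar : 'rV[R]_n.
Hypotheses (xmin : argmin (closure (Omega psi)) (Phi f rho) xstar)
  (xd : dom psi xstar).

Lemma argmin_dom_rho : dom rho xstar.
Proof.
have [y0O y0r] := y0_in; apply: dom_Phi_rho; rewrite /dom /=.
apply: (@le_lt_trans _ _ (Phi f rho y0)).
  by apply: (proj2 xmin); exact: subset_closure.
by rewrite PhiE ?ltry//; exact: Omega_dom.
Qed.

Lemma Phi_star_argmin : Phi_star psi f rho = (rPhi xstar)%:E.
Proof.
rewrite -PhiE//; last exact: argmin_dom_rho.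
have [xc xm] := xmin; apply/eqP; rewrite eq_le; apply/andP; split.
  by apply: ereal_inf_lbound; exists xstar.
by apply: le_ereal_inf_tmp => _ [v vc <-]; exact: xm.
Qed.

Lemma real_gap_ge0 v : dom psi v -> dom rho v -> 0 <= rPhi v - rPhi xstar.
Proof.
move=> vd vr; rewrite subr_ge0 -lee_fin -!PhiE//; last exact: argmin_dom_rho.
by apply: (proj2 xmin); exact: dom_closure_Omega.
Qed.

Lemma linear_rate s qmin : (forall N, is_run N s) -> 0 < qmin ->
  (forall k, (1 <= k)%N -> qmin <= rate mu (s k)) ->
  linear_convergence
    (fun k => Phi f rho (st_y (s k)) - Phi_star psi f rho)%E.
Proof.
move=> sR q0 qr; have xr := argmin_dom_rho.
have q1 : qmin < 1 := le_lt_trans (qr 1%N isT) (rate_lt1 (sR 1%N) (ltnSn 0)).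
pose r := 1 - qmin.
have r0 : 0 < r by rewrite /r; lra.
have D0 : 0 <= D xstar y0 by have [y0O _] := y0_in; apply: D_ge0.
have [_ w1 _] := run_step (sR 1%N) (ltnSn 0).
pose g0 := rPhi y0 - rPhi xstar.
have [y0O y0r] := y0_in.
have g00 : 0 <= g0 by apply: real_gap_ge0 => //; exact: Omega_dom.
pose A := D xstar y0 * (st_omega (s 1%N))^-1.
have A0 : 0 <= A by rewrite mulr_ge0// invr_ge0 ltW.
exists (g0 + A / r), r; split => //; first by rewrite /r; lra.
move=> k; have [yd yr] := run_y (sR k) (leqnn k).
rewrite Phi_star_argmin PhiE// -EFinB !lee_fin; split.
  exact: real_gap_ge0.
case: k yd yr => [|k] yd yr.
  rewrite (proj1 (sR 0%N)) /= expr0 mulr1 lerDl divr_ge0// ltW//.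
apply: le_trans (real_estimate _ (sR k.+1) xd xr) _ => //.
have Ar : A * r ^+ k <= (g0 + A / r) * r ^+ k.+1.
  have -> : (g0 + A / r) * r ^+ k.+1 = g0 * r ^+ k.+1 + A * r ^+ k.
    by rewrite exprSr; field; rewrite gt_eqF.
  by rewrite lerDr mulr_ge0// exprn_ge0// ltW.
apply: le_trans Ar.
rewrite /rbound mulrA -/A; apply: ler_wpM2l => //.
have -> : r ^+ k = \prod_(2 <= i < k.+2) r.
  by rewrite prodr_const_nat subSS subn1.
rewrite big_seq [leRHS]big_seq; apply: ler_prod => i.
rewrite mem_index_iota => /andP[i2 ik]; apply/andP; split.
  case: i i2 ik => // i _ ik.
  by rewrite subr_ge0 ltW// (rate_lt1 (sR k.+1)).
by rewrite /r lerD2l lerN2; apply: qr; exact: ltnW.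
Qed.

End minimizer.

End convergence.

(** * The Burg geometry *)

Section burg_kernel.
Context {R : realType}.
Implicit Types s t T M : R.

(** The Burg distance is the sum over the coordinates of [burg_kernel (u_j / v_j)]
    (the Itakura-Saito divergence). *)
Definition burg_kernel t : R := t - 1 - ln t.

Lemma ln_le_sub1 t : 0 < t -> ln t <= t - 1.
Proof.
by move=> t0; have := @le_ln1Dx R (t - 1); rewrite [1 + _]addrC subrK; apply; lra.
Qed.

Lemma ln_ge_subV t : 0 < t -> 1 - t^-1 <= ln t.
Proof.
move=> t0; have := @ln_le_sub1 t^-1; rewrite lnV ?posrE// invr_gt0.
by move=> /(_ t0); lra.
Qed.

Lemma burg_kernel_sqrt t : 0 < t -> (Num.sqrt t - 1) ^+ 2 <= burg_kernel t.
Proof.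
move=> t0; have r0 : 0 < Num.sqrt t by rewrite sqrtr_gt0.
have tE : t = Num.sqrt t * Num.sqrt t by rewrite -expr2 sqr_sqrtr// ltW.
rewrite /burg_kernel {2 3}tE lnM ?posrE//.
by have := ln_le_sub1 r0; lra.
Qed.

Lemma burg_kernel_ge0 t : 0 < t -> 0 <= burg_kernel t.
Proof. by move=> /burg_kernel_sqrt; apply: le_trans; exact: sqr_ge0. Qed.

Lemma burg_kernel_gt0 t : 0 < t -> t != 1 -> 0 < burg_kernel t.
Proof.
move=> t0 t1; apply: lt_le_trans (burg_kernel_sqrt t0).
rewrite exprn_even_gt0//= subr_eq0; apply: contra t1 => /eqP t1.
by rewrite -(sqr_sqrtr (ltW t0)) t1 expr1n.
Qed.

Lemma burg_kernel_lower t T : 0 < t -> t <= T ->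
  (t - 1) ^+ 2 <= 2 * (T + 1) * burg_kernel t.
Proof.
move=> t0 tT; have := burg_kernel_sqrt t0; set r := Num.sqrt t => H.
have tE : t = r ^+ 2 by rewrite sqr_sqrtr// ltW.
have -> : (t - 1) ^+ 2 = (r + 1) ^+ 2 * (r - 1) ^+ 2 by rewrite tE; ring.
apply: ler_pM; rewrite ?sqr_ge0//.
by have := sqr_ge0 (r - 1); move: tT; rewrite tE; lra.
Qed.

Lemma burg_kernel_upper t : 0 < t -> burg_kernel t <= t + t^-1.
Proof. by move=> t0; have := ln_ge_subV t0; rewrite /burg_kernel; lra. Qed.

Lemma burg_kernel_quadratic t : 1 / 2 <= t -> burg_kernel t <= 2 * (t - 1) ^+ 2.
Proof.
move=> t2; have t0 : 0 < t by lra.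
apply: (@le_trans _ _ ((t - 1) ^+ 2 * t^-1)).
  have := ln_ge_subV t0; rewrite /burg_kernel.
  have -> : (t - 1) ^+ 2 * t^-1 = t - 1 + t^-1 - 1 by field; rewrite gt_eqF.
  by lra.
rewrite mulrC; apply: ler_wpM2r; first exact: sqr_ge0.
by rewrite -[leLHS]mul1r ler_pdivrMr//; lra.
Qed.

Lemma burg_kernel_sublevel t M : 0 < t -> burg_kernel t <= M ->
  expR (- 1 - M) <= t <= 2 * M + 2.
Proof.
move=> t0 tM; apply/andP; split.
  rewrite -[leRHS](lnK (x := t)) ?posrE// ler_expR.
  by move: tM; rewrite /burg_kernel; lra.
have := le_trans (burg_kernel_sqrt t0) tM.
set r := Num.sqrt t => H; have -> : t = r ^+ 2 by rewrite sqr_sqrtr// ltW.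
by have := sqr_ge0 (r - 2); lra.
Qed.

(** The gap test in one coordinate, with [s = z / x] and [t = x / yh]; then
    the quantity [tau] is [z / zh]. The mirror step is short because [kappa] is
    large, so its cost is quadratic; each of the two squares it produces is
    absorbed by one of the two kernels on the right. *)
Lemma burg_kernel_trial (mu lambda kappa alpha omega theta s t S T : R) :
  let tau := 1 + alpha / theta * (mu * (s - 1) + s * (t - 1) / lambda) in
  0 < mu -> 0 < lambda -> lambda * mu <= 1 ->
  0 < kappa -> 0 < alpha -> 0 < omega -> 0 < theta ->
  kappa * alpha ^+ 2 = 2 * lambda * omega * theta -> mu * omega <= theta ->
  0 < s -> s <= S -> 0 < t -> t <= T ->
  8 * (S + 1) ^+ 2 <= kappa * mu * lambda -> 128 * (S + 1) ^+ 2 <= kappa ->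
  16 * S ^+ 2 * (T + 1) <= kappa ->
  1 / 2 <= tau /\ theta * burg_kernel tau <=
    mu * alpha * burg_kernel s + omega / lambda * burg_kernel t.
Proof.
move=> tau mu0 l0 lm k0 a0 w0 th0 kE thw s0 sS t0 tT K1 K2 K3.
set A := mu * (s - 1); set B := s * (t - 1) / lambda.
have tauE : tau - 1 = alpha / theta * (A + B) by rewrite /tau addrC addKr.
have S0 : 0 < S := lt_le_trans s0 sS.
have T0 : 0 < T := lt_le_trans t0 tT.
(* relative length of the mirror step *)
have step : alpha * (2 * (S + 1)) <= theta * lambda.
  have A1 : alpha ^+ 2 * (2 * (S + 1)) ^+ 2 <= (theta * lambda) ^+ 2.
    have k2 : kappa * (alpha ^+ 2 * (2 * (S + 1)) ^+ 2)
        <= kappa * (theta * lambda) ^+ 2.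
      rewrite mulrA kE.
      have -> : 2 * lambda * omega * theta * (2 * (S + 1)) ^+ 2
        = (lambda * theta * omega) * (8 * (S + 1) ^+ 2) by ring.
      have -> : kappa * (theta * lambda) ^+ 2
        = (lambda * theta * (theta / mu)) * (kappa * mu * lambda).
        by field; rewrite gt_eqF.
      have P0 : 0 <= lambda * theta by rewrite ltW// mulr_gt0.
      apply: ler_pM => //.
      - by apply: mulr_ge0 => //; exact: ltW.
      - by apply: mulr_ge0 => //; exact: sqr_ge0.
      - by apply: ler_wpM2l => //; rewrite ler_pdivlMr// mulrC.
    by move: k2; rewrite ler_pM2l.
  have p1 : 0 <= alpha * (2 * (S + 1)) by rewrite mulr_ge0 ?(ltW a0)//; lra.
  have p2 : 0 <= theta * lambda by rewrite ltW// mulr_gt0.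
  by rewrite -(@ler_pXn2r _ 2) ?nnegrE// exprMn.
have tau2 : 1 / 2 <= tau.
  have AB : - ((S + 1) / lambda) <= A + B.
    rewrite /A /B -(ler_pM2r l0) mulNr divfK ?gt_eqF// mulrDl divfK ?gt_eqF//.
    have : - (lambda * mu) <= mu * (s - 1) * lambda.
      have : 0 <= mu * s * lambda by rewrite !mulr_ge0// ltW.
      by lra.
    have : - s <= s * (t - 1) by have := mulr_gt0 s0 t0; lra.
    by lra.
  have at0 : 0 < alpha / theta by rewrite divr_gt0.
  suff : - (1 / 2) <= alpha / theta * (A + B) by rewrite -tauE; lra.
  apply: (@le_trans _ _ (alpha / theta * - ((S + 1) / lambda))); last first.
    by rewrite ler_pM2l.
  rewrite mulrN lerN2 -(ler_pM2r (mulr_gt0 th0 l0)).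
  have -> : alpha / theta * ((S + 1) / lambda) * (theta * lambda)
    = alpha * (S + 1) by field; rewrite !gt_eqF.
  by move: step; lra.
split => //.
have sq : theta * burg_kernel tau
    <= 8 * lambda * omega / kappa * (A ^+ 2 + B ^+ 2).
  apply: (@le_trans _ _ (theta * (2 * (tau - 1) ^+ 2))).
    by rewrite ler_pM2l//; exact: burg_kernel_quadratic.
  have -> : theta * (2 * (tau - 1) ^+ 2)
      = 4 * lambda * omega / kappa * (A + B) ^+ 2.
    have aE : alpha ^+ 2 = 2 * lambda * omega * theta / kappa.
      by rewrite -kE mulrAC divff ?gt_eqF// mul1r.
    rewrite tauE exprMn expr_div_n aE; field.
    by rewrite !gt_eqF.
  have c0 : 0 <= 4 * lambda * omega / kappa.
    by rewrite divr_ge0 ?(ltW k0)// !mulr_ge0// ltW.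
  have -> : 8 * lambda * omega / kappa * (A ^+ 2 + B ^+ 2)
    = 4 * lambda * omega / kappa * (2 * (A ^+ 2 + B ^+ 2)) by ring.
  by apply: ler_wpM2l => //; have := sqr_ge0 (A - B); lra.
apply: (le_trans sq); rewrite mulrDr; apply: lerD.
  apply: (@le_trans _ _ (mu * alpha * ((s - 1) ^+ 2 / (2 * (S + 1))))); last first.
    rewrite ler_pM2l ?mulr_gt0// ler_pdivrMr ?mulr_gt0//; last by lra.
    by rewrite mulrC; exact: burg_kernel_lower.
  have wk : 16 * lambda * omega * mu * (S + 1) <= kappa * alpha.
    have p1 : 0 <= 16 * lambda * omega * mu * (S + 1).
      by rewrite !mulr_ge0 ?(ltW l0) ?(ltW w0) ?(ltW mu0)//; lra.
    have p2 : 0 <= kappa * alpha by rewrite ltW// mulr_gt0.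
    rewrite -(@ler_pXn2r _ 2) ?nnegrE//.
    have -> : (kappa * alpha) ^+ 2 = kappa * (kappa * alpha ^+ 2) by ring.
    rewrite kE.
    apply: (@le_trans _ _ (kappa * (2 * lambda * omega * (mu * omega)))); last first.
      by rewrite ler_pM2l// ler_pM2l// !mulr_gt0.
    have -> : (16 * lambda * omega * mu * (S + 1)) ^+ 2
      = (2 * (lambda * mu) * omega ^+ 2) * (128 * (S + 1) ^+ 2 * (lambda * mu)).
      by ring.
    have -> : kappa * (2 * lambda * omega * (mu * omega))
      = (2 * (lambda * mu) * omega ^+ 2) * kappa by ring.
    apply: ler_wpM2l; first by rewrite !mulr_ge0 ?sqr_ge0// ltW.
    apply: le_trans K2; rewrite -[leRHS]mulr1; apply: ler_wpM2l => //.
    by rewrite mulr_ge0// sqr_ge0.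
  rewrite /A -(ler_pM2r k0).
  rewrite -(@ler_pM2r _ (2 * (S + 1))); last by lra.
  have -> : 8 * lambda * omega / kappa * (mu * (s - 1)) ^+ 2 * kappa * (2 * (S + 1))
    = mu * (s - 1) ^+ 2 * (16 * lambda * omega * mu * (S + 1)).
    by field; rewrite gt_eqF.
  have -> : mu * alpha * ((s - 1) ^+ 2 / (2 * (S + 1))) * kappa * (2 * (S + 1))
    = mu * (s - 1) ^+ 2 * (kappa * alpha).
    by field; rewrite gt_eqF//; lra.
  by apply: ler_wpM2l => //; rewrite mulr_ge0 ?sqr_ge0// ltW.
apply: (@le_trans _ _ (omega / lambda * ((t - 1) ^+ 2 / (2 * (T + 1))))); last first.
  rewrite ler_pM2l ?divr_gt0// ler_pdivrMr ?mulr_gt0//; last by lra.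
  by rewrite mulrC; exact: burg_kernel_lower.
have s2 : 16 * s ^+ 2 * (T + 1) <= kappa.
  apply: le_trans K3; apply: ler_wpM2r; first by lra.
  apply: ler_wpM2l => //.
  by rewrite ler_pXn2r ?nnegrE// ltW.
rewrite /B -(ler_pM2r k0).
rewrite -(@ler_pM2r _ (2 * (T + 1))); last by lra.
have -> : 8 * lambda * omega / kappa * (s * (t - 1) / lambda) ^+ 2 * kappa * (2 * (T + 1))
  = omega / lambda * (t - 1) ^+ 2 * (16 * s ^+ 2 * (T + 1)).
  by field; rewrite !gt_eqF.
have -> : omega / lambda * ((t - 1) ^+ 2 / (2 * (T + 1))) * kappa * (2 * (T + 1))
  = omega / lambda * (t - 1) ^+ 2 * kappa.
  by field; rewrite !gt_eqF//; lra.
by apply: ler_wpM2l => //; rewrite mulr_ge0 ?sqr_ge0// divr_ge0// ltW.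
Qed.

End burg_kernel.

Section burg_geometry.
Context {R : realType} {n : nat}.
Implicit Types (u v x y z p : 'rV[R]_n).
Local Notation burg := (@burg R n).

Lemma burg_EFin x : (forall j, 0 < x 0 j) ->
  burg x = (- \sum_(j < n) ln (x 0 j))%:E.
Proof. by move=> x0; rewrite /Defs.burg; case: ifPn => // /forallP. Qed.

Lemma dom_burgP x : dom burg x <-> forall j, 0 < x 0 j.
Proof.
split=> [|x0]; last by rewrite /dom /= burg_EFin// ltry.
by rewrite /dom /= /Defs.burg; case: ifPn => [/forallP//|_]; rewrite ltxx.
Qed.

Lemma Omega_burgP x : Omega burg x <-> forall j, 0 < x 0 j.
Proof.
split=> [/interior_subset/dom_burgP//|x0].
have : nbhs x (fun y : 'rV[R]_n => forall j, 0 < y 0 j).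
  apply: (@filter_forall _ _ (fun j (y : 'rV[R]_n) => 0 < y 0 j) (nbhs x)
    (nbhs_filter x)) => j.
  have cj := @coord_continuous R 1 n 0 j x.
  exact: cvgr_gt _ cj _ (x0 j).
by apply: filterS => y /dom_burgP.
Qed.

Lemma burg_coord_step v j (s : R) : (forall i, 0 < v 0 i) -> -1 < s ->
  fine (burg (v + s *: (v 0 j *: delta_mx 0 j))) - fine (burg v)
  = - ln (1 + s).
Proof.
move=> v0 s1; set w := v + _.
have wj : w 0 j = v 0 j * (1 + s).
  by rewrite !mxE !eqxx /=; ring.
have wi i : i != j -> w 0 i = v 0 i.
  by move=> ij; rewrite !mxE (negbTE ij) andbF !mulr0 addr0.
have w0 i : 0 < w 0 i.
  have [->|ij] := eqVneq i j; last by rewrite wi.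
  by rewrite wj mulr_gt0//; lra.
rewrite !burg_EFin//= (bigD1 j)//= [in X in _ - - X](bigD1 j)//=.
rewrite (eq_bigr (fun i => ln (v 0 i))) => [|i ij]; last by rewrite wi.
by rewrite wj lnM ?posrE//; lra.
Qed.

Hypothesis burg_legendre : legendre burg.

Let burgP : proper_fun burg. Proof. by case: burg_legendre. Qed.
Let burgD x : Omega burg x -> edifferentiable burg x.
Proof. by case: burg_legendre => _ _ _ [_ + _] _; apply. Qed.

(** Along the coordinate direction scaled by [v 0 j], the inequality
    [ln t <= t - 1] bounds the two one-sided slopes by the same value. *)
Lemma grad_burg v j : Omega burg v -> grad burg v 0 j = - (v 0 j)^-1.
Proof.
move=> vO; have v0 := proj1 (Omega_burgP v) vO.
have g1 : -1 <= v 0 j * grad burg v 0 j.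
  rewrite -(dot_delta (grad burg v)) -dotZr; apply: ge_dot_grad; first exact: burgD.
  move=> t t0 t1; rewrite burg_coord_step//; last by lra.
  by have := @ln_le_sub1 R (1 + t); lra.
have g2 : v 0 j * grad burg v 0 j <= -1.
  rewrite -[leLHS]opprK lerN2 -mulNr -(dot_delta (grad burg v)) -dotZr.
  apply: ge_dot_grad; first exact: burgD.
  move=> t t0 t1; rewrite scaleNr scalerN -scaleNr burg_coord_step//; last by lra.
  by have := @ln_le_sub1 R (1 - t); lra.
have vg : v 0 j * grad burg v 0 j = -1 by apply/eqP; rewrite eq_le g1 g2.
by rewrite -[LHS](mulKf (lt0r_neq0 (v0 j))) vg mulrN1.
Qed.

Lemma rbregman_burg u v : Omega burg u -> Omega burg v ->
  rbregman burg u v = \sum_(j < n) burg_kernel (u 0 j / v 0 j).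
Proof.
move=> uO vO; have u0 := proj1 (Omega_burgP u) uO.
have v0 := proj1 (Omega_burgP v) vO.
rewrite /rbregman !burg_EFin//= /dot -!sumrN -!big_split /=.
apply: eq_bigr => j _; rewrite grad_burg// !mxE /burg_kernel ln_div ?posrE//.
by field; rewrite gt_eqF.
Qed.

Lemma burg_kernel_le_rbregman u v j : Omega burg u -> Omega burg v ->
  burg_kernel (u 0 j / v 0 j) <= rbregman burg u v.
Proof.
move=> uO vO; have u0 := proj1 (Omega_burgP u) uO.
have v0 := proj1 (Omega_burgP v) vO.
rewrite rbregman_burg// (bigD1 j)//= lerDl sumr_ge0// => i _.
by rewrite burg_kernel_ge0// divr_gt0.
Qed.

Lemma rbregman_burg_gt0 u v : Omega burg u -> Omega burg v -> u <> v ->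
  0 < rbregman burg u v.
Proof.
move=> uO vO uv; have u0 := proj1 (Omega_burgP u) uO.
have v0 := proj1 (Omega_burgP v) vO.
have [j /eqP uvj] : exists j, u 0 j <> v 0 j.
  apply: contrapT => H; apply: uv; apply/rowP => j.
  by apply: contrapT => uvj; apply: H; exists j.
apply: lt_le_trans (burg_kernel_le_rbregman j uO vO).
apply: burg_kernel_gt0; first by rewrite divr_gt0.
by apply: contra uvj => /eqP/divr1_eq ->.
Qed.

Lemma negative_dual_burg p : (forall j, p 0 j < 0) ->
  interior (dom (conjugate burg)) p.
Proof.
move=> p0.
have : nbhs p (fun q : 'rV[R]_n => forall j, q 0 j < 0).
  apply: (@filter_forall _ _ (fun j (y : 'rV[R]_n) => y 0 j < 0) (nbhs p)
    (nbhs_filter p)) => j.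
  have cj := @coord_continuous R 1 n 0 j p.
  exact: cvgr_lt _ cj _ (p0 j).
apply: filterS => q q0.
apply: (@le_lt_trans _ _ (\sum_(j < n) (- ln (- q 0 j)))%:E); last exact: ltry.
apply: conjugate_le => // u /dom_burgP u0.
rewrite burg_EFin//= opprK /dot -big_split; apply: ler_sum => j _ /=.
have qj : 0 < - q 0 j by rewrite oppr_gt0.
have := ln_le_sub1 (mulr_gt0 qj (u0 j)); rewrite lnM ?posrE//.
by lra.
Qed.

End burg_geometry.

(** * Boundedness of [kappa] for the Burg geometry *)

Section box.
Context {R : realType} {n : nat}.
Implicit Types (u v : 'rV[R]_n) (a b : R).

Definition in_box a b u := forall j, a <= u 0 j <= b.

Lemma in_boxW a b a' b' u : a' <= a -> b <= b' -> in_box a b u -> in_box a' b' u.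
Proof.
by move=> aa bb H j; have /andP[h1 h2] := H j; rewrite (le_trans aa h1) (le_trans h2 bb).
Qed.

Lemma positive_in_box u : (forall j, 0 < u 0 j) ->
  exists a b, 0 < a /\ in_box a b u.
Proof.
move=> u0; pose s := \sum_(j < n) (u 0 j)^-1; pose t := \sum_(j < n) u 0 j.
have s0 : 0 <= s by apply: sumr_ge0 => j _; rewrite invr_ge0 ltW.
exists (1 + s)^-1, t; split; first by rewrite invr_gt0; lra.
move=> j; apply/andP; split; last first.
  by rewrite /t (bigD1 j)//= lerDl; apply: sumr_ge0 => i _; exact: ltW.
rewrite -[leRHS]invrK lef_pV2 ?posrE ?invr_gt0//; last by lra.
have : (u 0 j)^-1 <= s.
  rewrite /s (bigD1 j)//= lerDl; apply: sumr_ge0 => i _.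
  by rewrite invr_ge0 ltW.
by lra.
Qed.

End box.

Section burg_run.
Context {R : realType} {n : nat} (f rho : 'rV[R]_n -> \bar R)
  (L mu gplus gminus gkappa lambda0 kappa0 : R) (y0 : 'rV[R]_n).
Local Notation psi := (@burg R n).
Context (psi_legendre : legendre psi) (f_proper : proper_fun f)
  (f_lsc : lower_semicontinuous f)
  (dom_psi_f : dom psi `<=` dom f) (rho_proper : proper_fun rho)
  (rho_lsc : lower_semicontinuous rho) (rho_convex : econvex rho)
  (Omega_dom_rho : (Omega psi `&` dom rho) !=set0) (L_gt0 : 0 < L)
  (f_smooth : forall u v : 'rV[R]_n, Omega psi u -> Omega psi v ->
      (bregman f u v <= L%:E * bregman psi u v)%E)
  (solvable : forall x (lambda : R), Omega psi x -> 0 < lambda ->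
      bpg psi f rho lambda x !=set0)
  (mu_gt0 : 0 < mu)
  (f_strong : forall u v : 'rV[R]_n, closure (Omega psi) u -> Omega psi v ->
      (mu%:E * bregman psi u v <= bregman f u v)%E)
  (y0_in : (Omega psi `&` dom rho) y0) (lambda0_gt0 : 0 < lambda0)
  (kappa0_gt0 : 0 < kappa0)
  (gplus_ge1 : 1 <= gplus) (gminus_gt1 : 1 < gminus) (gkappa_gt1 : 1 < gkappa).
Implicit Types (u v x yh : 'rV[R]_n).

Local Notation D := (rbregman psi).
Local Notation rPhi := (rPhi f rho).
Local Notation feasible := (feasible psi rho mu).
Local Notation search := (search psi f rho mu gminus gkappa).
Local Notation is_run := (run psi f rho mu gplus gminus gkappa y0 lambda0 kappa0).

Let psiP : proper_fun psi. Proof. by case: psi_legendre. Qed.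
Let f_real_strong u v : Omega psi u -> Omega psi v ->
  mu * D u v <= rbregman f u v.
Proof.
by move=> uO vO; apply: real_strong => //; exact: Omega_dom.
Qed.
Let Dge0 u v : Omega psi u -> Omega psi v -> 0 <= D u v.
Proof. by move=> uO vO; apply: D_ge0 => //; exact: Omega_dom. Qed.

Lemma real_smooth u v : Omega psi u -> Omega psi v ->
  rbregman f u v <= L * D u v.
Proof.
move=> uO vO; have := f_smooth uO vO.
have ud := Omega_dom uO; have vd := Omega_dom vO.
by rewrite (bregmanE psiP ud vd) (bregmanE f_proper (dom_psi_f ud) (dom_psi_f vd)).
Qed.

(** Solvability of the proximal problem for the long step [2 / mu] leaves half
    of the strong convexity of [f] to make [Phi] coercive. *)
Lemma Phi_coercive : exists c, forall u, Omega psi u -> dom rho u ->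
  c + mu / 2 * D u y0 <= rPhi u.
Proof.
have [y0O y0r] := y0_in; have l0 : 0 < 2 / mu by rewrite divr_gt0.
have [yh yB] := solvable y0O l0.
exists (fine (f y0) + (fine (rho yh) + dot (grad f y0) (yh - y0)
  + (2 / mu)^-1 * D yh y0)) => u uO ur.
have := bpg_le psi_legendre rho_proper rho_convex Omega_dom_rho l0 y0O yB
  (Omega_dom uO) ur.
have := f_real_strong uO y0O.
rewrite invf_div [rbregman f u y0]/rbregman /rPhi.
move: (dot (grad f y0) (u - y0)) (dot (grad f y0) (yh - y0)) => d1 d2.
by move: (D u y0) (D yh y0) => d3 d4; lra.
Qed.

(** The Burg kernel is infinite at 0 and at infinity, so a bound on the Burg
    distance to a fixed point confines every coordinate. *)
Lemma Phi_sublevel_box M : exists a b, 0 < a /\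
  forall u, Omega psi u -> dom rho u -> rPhi u <= M -> in_box a b u.
Proof.
have [c hc] := Phi_coercive; have [y0O y0r] := y0_in.
have y0p := proj1 (Omega_burgP y0) y0O.
have [a [b [a0 ab]]] := positive_in_box y0p.
pose M' := Num.max 0 (2 / mu * (M - c)).
have M'0 : 0 <= M' by rewrite /M' le_max lexx.
exists (expR (- 1 - M') * a), ((2 * M' + 2) * b); split.
  by rewrite mulr_gt0// expR_gt0.
move=> u uO ur uM j; have up := proj1 (Omega_burgP u) uO.
have DM : D u y0 <= M'.
  rewrite /M' le_max; apply/orP; right.
  have := hc u uO ur; rewrite -ler_pdivrMl ?divr_gt0// invf_div.
  by lra.
have := burg_kernel_le_rbregman psi_legendre j uO y0O.
move=> /le_trans/(_ DM)/burg_kernel_sublevel.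
rewrite divr_gt0// => /(_ isT); rewrite ler_pdivlMr// ler_pdivrMr//.
have /andP[aj bj] := ab j; move=> /andP[h1 h2].
rewrite (le_trans _ h1) ?(le_trans h2)//; first by apply: ler_wpM2l => //; lra.
by apply: ler_wpM2l => //; exact: expR_ge0.
Qed.

(** [f] is infinite on the boundary, where its Bregman distance dominates the
    infinite Burg distance; so a minimizer over a compact sublevel box is a
    minimizer over the closed orthant. *)
Lemma Phi_argmin : exists2 xstar, argmin (closure (Omega psi)) (Phi f rho) xstar
  & Omega psi xstar.
Proof.
have [y0O y0r] := y0_in; have y0d := Omega_dom y0O.
have [a [b [a0 hab]]] := Phi_sublevel_box (rPhi y0).
have Phil : lower_semicontinuous (Phi f rho).
  by apply: lsc_add => //; [case: f_proper|case: rho_proper].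
pose K := [set u : 'rV[R]_n | forall j, a <= u 0 j <= b].
have Ky0 : K y0 by exact: hab.
have [x Kx xm] := @lsc_compact_argmin _ _ K _
  (@compact_box R n (fun=> a) (fun=> b)) (ex_intro _ y0 Ky0) Phil.
have xO : Omega psi x.
  by apply/Omega_burgP => j; have /andP[h _] := Kx j; exact: lt_le_trans h.
exists x => //; split; first exact: subset_closure.
move=> v vc; have [vO|vO] := pselect (Omega psi v); last first.
  have : (mu%:E * bregman psi v y0 <= bregman f v y0)%E by exact: f_strong.
  have pv : psi v = +oo%E.
    apply: contra_notP vO => pv; apply/Omega_burgP/dom_burgP.
    by rewrite /dom /= lt_neqAle leey andbT; apply/eqP.
  rewrite /bregman pv (dom_fineK psiP y0d).
  rewrite (dom_fineK f_proper (dom_psi_f y0d)) /= gt0_muley ?lte_fin//.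
  have := proj1 f_proper v; have := proj1 rho_proper v.
  rewrite /Phi; case: (f v) => [r||] //=; case: (rho v) => [q||] //= _ _ _;
    exact: leey.
have vd := Omega_dom vO.
have [vr|vr] := pselect (dom rho v); last first.
  have -> : Phi f rho v = +oo%E; last exact: leey.
  rewrite /Phi; have -> : rho v = +oo%E.
    apply: contra_notP vr => rv.
    by rewrite /dom /= lt_neqAle leey andbT; apply/eqP.
  by rewrite addey// (dom_fineK f_proper (dom_psi_f vd)).
have [vy|/ltW vy] := leP (rPhi v) (rPhi y0); first by apply: xm; exact: hab.
by apply: le_trans (xm y0 Ky0) _; rewrite !(PhiE f_proper dom_psi_f rho_proper).
Qed.

Lemma dual_box u M : Omega psi u -> 0 <= M -> exists a b, 0 < a /\
  forall z, Omega psi z -> D u z <= M -> in_box a b z.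
Proof.
move=> uO M0; have up := proj1 (Omega_burgP u) uO.
have [a [b [a0 ab]]] := positive_in_box up.
have m0 : 0 < 2 * M + 2 by lra.
have e0 : 0 < expR (- 1 - M) :> R by exact: expR_gt0.
exists (a / (2 * M + 2)), (b / expR (- 1 - M)); split; first exact: divr_gt0.
move=> z zO zM j; have zp := proj1 (Omega_burgP z) zO.
have := burg_kernel_le_rbregman psi_legendre j uO zO.
move=> /le_trans/(_ zM)/burg_kernel_sublevel.
rewrite divr_gt0// => /(_ isT); rewrite ler_pdivlMr// ler_pdivrMr//.
have /andP[aj bj] := ab j; move=> /andP[h1 h2].
rewrite ler_pdivrMr// ler_pdivlMr// (le_trans aj) ?(le_trans _ bj)//.
  by rewrite mulrC.
by rewrite mulrC.
Qed.

Section trial.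
Variables (s : @state R n) (lambda kappa : R) (yh : 'rV[R]_n).
Local Notation alpha := (tr_alpha mu s lambda kappa).
Local Notation omega := (tr_omega mu s lambda kappa).
Local Notation theta := (tr_theta mu s lambda kappa).
Local Notation x := (tr_x mu s lambda kappa).
Hypotheses (sF : feasible s) (lambda_gt0 : 0 < lambda)
  (continues : tr_continues psi f rho mu s lambda kappa yh).

Let kappa_gt : 2 * mu * lambda < kappa. Proof. by case: continues. Qed.
Let yB : bpg psi f rho lambda x yh. Proof. by case: continues. Qed.
Let xO : Omega psi x.
Proof. exact: (tr_x_Omega psi_legendre mu_gt0 sF lambda_gt0 kappa_gt). Qed.
Let yhO : Omega psi yh.
Proof.
by have [] := bpg_Omega psi_legendre rho_proper rho_convex Omega_dom_rho
  lambda_gt0 xO yB.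
Qed.
Let yhr : dom rho yh.
Proof.
by have [] := bpg_Omega psi_legendre rho_proper rho_convex Omega_dom_rho
  lambda_gt0 xO yB.
Qed.

Lemma tr_descentE : tr_descent psi f mu s lambda kappa yh <->
  rbregman f yh x <= lambda^-1 * D yh x.
Proof.
have yd := Omega_dom yhO; have xd := Omega_dom xO.
rewrite /tr_descent (bregmanE psiP yd xd).
by rewrite (bregmanE f_proper (dom_psi_f yd) (dom_psi_f xd)).
Qed.

Lemma tr_descent_small : lambda * L <= 1 ->
  tr_descent psi f mu s lambda kappa yh.
Proof.
move=> lL; apply/tr_descentE; apply: le_trans (real_smooth yhO xO) _.
apply: ler_wpM2r; first exact: Dge0.
by rewrite -[leRHS]mulr1 ler_pdivlMl.
Qed.

Lemma tr_descent_lambda : tr_descent psi f mu s lambda kappa yh ->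
  lambda * mu <= 1.
Proof.
move=> /tr_descentE dE; have [_ _ yx] := continues.
have D0 := rbregman_burg_gt0 psi_legendre yhO xO yx.
have := le_trans (f_real_strong yhO xO) dE; rewrite ler_pM2r//.
by rewrite -[leRHS]mulr1 ler_pdivlMl.
Qed.

Lemma tr_x_box a b : in_box a b (st_y s) -> in_box a b (st_z s) -> in_box a b x.
Proof.
move=> yb zb j; have /andP[ya yb'] := yb j; have /andP[za zb'] := zb j.
have [_ _ _ w0 _] := sF.
have ap := tr_alpha_gt0 mu_gt0 sF lambda_gt0 kappa_gt.
have wp := tr_omega_gt0 mu_gt0 sF lambda_gt0 kappa_gt.
rewrite !mxE mulrC ler_pdivlMr// ler_pdivrMr//.
have -> : omega = st_omega s + alpha by [].
have := ler_wpM2l w0 ya; have := ler_wpM2l w0 yb'.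
have := ler_wpM2l (ltW ap) za; have := ler_wpM2l (ltW ap) zb'.
by move: alpha => al; lra.
Qed.

(** A proximal point that passes the descent test is no worse than the model at
    [u], hence lies in a sublevel set of [Phi]. *)
Lemma tr_descent_Phi u : Omega psi u -> dom rho u ->
  tr_descent psi f mu s lambda kappa yh ->
  rPhi yh <= rPhi u + lambda^-1 * D u x.
Proof.
move=> uO ur /tr_descentE.
have := bpg_le psi_legendre rho_proper rho_convex Omega_dom_rho lambda_gt0 xO yB
  (Omega_dom uO) ur.
have := f_real_strong uO xO.
have : 0 <= mu * D u x by rewrite mulr_ge0 ?Dge0// ltW.
rewrite [rbregman f u x]/rbregman [rbregman f yh x]/rbregman /rPhi.
move: (dot (grad f x) (u - x)) (dot (grad f x) (yh - x)) => d1 d2.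
by move: (D u x) (D yh x) => d3 d4; lra.
Qed.

Lemma burg_trial a b : 0 < a -> in_box a b (st_y s) -> in_box a b (st_z s) ->
  in_box a b yh -> tr_descent psi f mu s lambda kappa yh ->
  8 * (b / a + 1) ^+ 2 <= kappa * mu * lambda ->
  128 * (b / a + 1) ^+ 2 <= kappa ->
  16 * (b / a) ^+ 2 * (b / a + 1) <= kappa ->
  tr_dual psi mu s lambda kappa yh /\ tr_gap psi f mu s lambda kappa yh.
Proof.
move=> a0 yb zb yhb dc K1 K2 K3.
have lm := tr_descent_lambda dc; have xb := tr_x_box yb zb.
have [yO _ zO w0 thE] := sF.
have ap := tr_alpha_gt0 mu_gt0 sF lambda_gt0 kappa_gt.
have wp := tr_omega_gt0 mu_gt0 sF lambda_gt0 kappa_gt.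
have thp := tr_theta_gt0 mu_gt0 sF lambda_gt0 kappa_gt.
have zp := proj1 (Omega_burgP _) zO; have xp := proj1 (Omega_burgP _) xO.
have yhp := proj1 (Omega_burgP _) yhO.
have k0 : 0 < kappa.
  by apply: lt_trans kappa_gt; rewrite !mulr_gt0.
have ratio u v j : in_box a b u -> in_box a b v -> u 0 j / v 0 j <= b / a.
  move=> ub vb; have /andP[ua ub'] := ub j; have /andP[va vb'] := vb j.
  rewrite ler_pdivrMr ?(lt_le_trans a0)// (le_trans ub')//.
  rewrite mulrAC ler_pdivlMr//; apply: ler_wpM2l => //.
  exact: le_trans (ltW a0) (le_trans ua ub').
pose tau j := 1 + alpha / theta * (mu * (st_z s 0 j / x 0 j - 1)
  + st_z s 0 j / x 0 j * (x 0 j / yh 0 j - 1) / lambda).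
have thw : mu * omega <= theta.
  by rewrite (tr_thetaE lambda kappa sF) lerDr.
have T j := burg_kernel_trial mu_gt0 lambda_gt0 lm k0 ap wp thp
  (tr_alpha_eq mu_gt0 sF lambda_gt0 kappa_gt) thw
  (divr_gt0 (zp j) (xp j)) (ratio _ _ j zb xb)
  (divr_gt0 (xp j) (yhp j)) (ratio _ _ j xb yhb) K1 K2 K3.
set p := tr_p psi mu s lambda kappa yh.
have pE j : - (st_z s 0 j * p 0 j) = tau j.
  rewrite /p /tr_p /bpg_residual /tau.
  move: (grad_burg psi_legendre j zO) (grad_burg psi_legendre j xO)
    (grad_burg psi_legendre j yhO).
  have -> : st_theta s = theta - mu * alpha by rewrite /tr_theta addrK.
  move: (grad psi (st_z s)) (grad psi x) (grad psi yh) => gz gx gy.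
  move: thp (xp j) (zp j) (yhp j).
  move: theta alpha (tr_x mu s lambda kappa) => th al X t0 x0 z0 y1 ez ex ey.
  rewrite !mxE ez ex ey.
  by field; rewrite !gt_eqF.
have dual : tr_dual psi mu s lambda kappa yh.
  apply: (negative_dual_burg psi_legendre) => j; rewrite -/p.
  rewrite -oppr_gt0 -(pmulr_rgt0 _ (zp j)) mulrN pE.
  by have [h _] := T j; apply: lt_le_trans h; lra.
split => //.
have [zhO zhE] := tr_z_dual psi_legendre dual.
apply/(tr_gapE psi_legendre f_proper dom_psi_f rho_proper rho_convex
  Omega_dom_rho mu_gt0 sF lambda_gt0 kappa_gt yB zhO).
have zhp := proj1 (Omega_burgP _) zhO.
have Dz : theta * D (st_z s) (tr_z psi mu s lambda kappa yh)
    <= mu * alpha * D (st_z s) x + omega / lambda * D x yh.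
  rewrite !rbregman_burg// !mulr_sumr -big_split; apply: ler_sum => j _ /=.
  have -> : st_z s 0 j / tr_z psi mu s lambda kappa yh 0 j = tau j.
    rewrite -pE; have -> : p 0 j = - (tr_z psi mu s lambda kappa yh 0 j)^-1.
      have := congr1 (fun q : 'rV[R]_n => q 0 j) zhE => /= <-.
      exact: grad_burg.
    by rewrite mulrN opprK.
  by have [_] := T j.
have Dyx : 0 <= mu * (st_omega s * D (st_y s) x).
  by rewrite !mulr_ge0 ?Dge0// ltW.
have PP : omega / lambda * D x yh <= omega * real_P psi f lambda x yh.
  rewrite -mulrA ler_pM2l// /real_P.
  move/tr_descentE: dc; move: (rbregman f yh x) => df.
  by abstract_scalars; lra.
move: Dz Dyx PP; move: (real_P _ _ _ _ _) (omega / lambda) => P wl.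
by abstract_scalars; lra.
Qed.

End trial.

(** Within one iteration [kappa] grows by the factor [gkappa] only from values
    below the threshold [2 * mu * lambda] or below the value [kbar] that makes
    every trial pass, while [lambda] stays between fixed bounds. *)
Lemma search_kappa_le (s s' : @state R n) lambda kappa lmin lmax kbar K :
  0 < lmin -> lmin * gminus * L <= 1 -> feasible s ->
  (forall l k yh, lmin <= l -> tr_continues psi f rho mu s l k yh ->
     tr_descent psi f mu s l k yh -> kbar <= k ->
     tr_dual psi mu s l k yh /\ tr_gap psi f mu s l k yh) ->
  gkappa * kbar <= K -> gkappa * (2 * mu * lmax) <= K ->
  search s lambda kappa s' -> lmin <= lambda <= lmax -> kappa <= K ->
  [/\ lmin <= st_lambda s', st_lambda s' * mu <= 1 & st_kappa s' <= K].
Proof.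
move=> lmin0 lminL sF pass Kb Kl.
have g0 : 0 < gkappa by apply: lt_trans gkappa_gt1.
have gm0 : 0 < gminus by apply: lt_trans gminus_gt1.
elim=> {lambda kappa s'}.
- move=> lambda kappa s' kl _ IH /andP[l1 l2] kK; apply: IH; first by rewrite l1.
  apply: le_trans Kl; rewrite ler_pM2l//; apply: le_trans kl _.
  by rewrite ler_pM2l// mulr_gt0.
- move=> lambda kappa yh s' c nd _ IH /andP[l1 l2] kK; apply: IH => //.
  have l0 : 0 < lambda by apply: lt_le_trans l1.
  have lL : 1 < lambda * L.
    by rewrite ltNge; apply/negP => lL; apply: nd; exact: tr_descent_small.
  apply/andP; split.
    by rewrite ler_pdivlMr// -(ler_pM2r L_gt0); lra.
  by apply: le_trans l2; rewrite ler_pdivrMr// ler_peMr// ltW.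
- move=> lambda kappa yh s' c d nd _ IH /andP[l1 l2] kK.
  apply: IH; first by rewrite l1.
  have [kk|kk] := leP kbar kappa; first by case: nd; case: (pass _ _ _ l1 c d kk).
  by apply: le_trans Kb; rewrite ler_pM2l// ltW.
- move=> lambda kappa yh s' c d du ng _ IH /andP[l1 l2] kK.
  apply: IH; first by rewrite l1.
  have [kk|kk] := leP kbar kappa; first by case: ng; case: (pass _ _ _ l1 c d kk).
  by apply: le_trans Kb; rewrite ler_pM2l// ltW.
- move=> lambda kappa yh c d du g /andP[l1 l2] kK; split => //=.
  by apply: (tr_descent_lambda sF _ c d); exact: lt_le_trans l1.
Qed.

Section run.
Variable s : nat -> @state R n.
Hypothesis sR : forall N, is_run N s.

Let sI k : [/\ feasible (s k), 0 < st_lambda (s k) &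
    forall u, dom psi u -> dom rho u ->
      energy psi f rho u (s k) <= D u y0].
Proof.
exact: (run_invariant psi_legendre f_proper dom_psi_f rho_proper rho_convex
  Omega_dom_rho mu_gt0 f_strong y0_in lambda0_gt0 gplus_ge1 gminus_gt1
  (sR k) (leqnn k)).
Qed.

Variable xstar : 'rV[R]_n.
Hypotheses (xmin : argmin (closure (Omega psi)) (Phi f rho) xstar)
  (xO : Omega psi xstar).

Let xd : dom psi xstar. Proof. exact: Omega_dom. Qed.
Let xr : dom rho xstar.
Proof. exact: (argmin_dom_rho f_proper dom_psi_f rho_proper y0_in xmin). Qed.
Let gap_ge0 v : dom psi v -> dom rho v -> 0 <= rPhi v - rPhi xstar.
Proof.
exact: (real_gap_ge0 psi_legendre f_proper dom_psi_f rho_proper y0_in xmin xd).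
Qed.

(** The energy bound keeps the dual iterates in a Bregman ball and the primal
    iterates in a sublevel set; both are bounded away from the boundary. *)
Lemma run_box : exists a b, 0 < a /\
  forall k, in_box a b (st_y (s k)) /\ in_box a b (st_z (s k)).
Proof.
have [y0O y0r] := y0_in; have y0d := Omega_dom y0O.
have D0 : 0 <= D xstar y0 by exact: Dge0.
have [a1 [b1 [a10 h1]]] := dual_box xO D0.
have step k := run_step psi_legendre f_proper dom_psi_f rho_proper rho_convex
  Omega_dom_rho mu_gt0 f_strong y0_in lambda0_gt0 gplus_ge1 gminus_gt1
  (sR k.+1) (ltnSn k).
have [_ w1 _] := step 0%N.
pose M := rPhi y0 + D xstar y0 / st_omega (s 1%N).
have Dw0 : 0 <= D xstar y0 / st_omega (s 1%N) by rewrite divr_ge0// ltW.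
have [a2 [b2 [a20 h2]]] := Phi_sublevel_box M.
exists (Num.min a1 a2), (Num.max b1 b2); split; first by rewrite lt_min a10 a20.
move=> k; have [[yO yr zO w0 thE] _ E] := sI k; split.
  apply: (@in_boxW _ _ a2 b2); rewrite ?ge_min ?le_max ?lexx ?orbT//.
  apply: h2 => //; case: k yO yr zO w0 thE E => [|k] yO yr _ _ _ _.
    by rewrite (proj1 (sR 0%N)) /= lerDl.
  have := real_estimate psi_legendre f_proper dom_psi_f rho_proper rho_convex
    Omega_dom_rho mu_gt0 f_strong y0_in lambda0_gt0 gplus_ge1 gminus_gt1
    (isT : (1 <= k.+1)%N) (sR k.+1) xd xr.
  have rb : rbound mu s k.+1 <= (st_omega (s 1%N))^-1.
    rewrite /rbound -[leRHS]mulr1 ler_pM2l ?invr_gt0//.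
    rewrite big_seq; apply: prodr_ile1 => -[|i]; rewrite mem_index_iota//.
    move=> /andP[_ ik].
    have r1 := rate_lt1 psi_legendre f_proper dom_psi_f rho_proper rho_convex
      Omega_dom_rho mu_gt0 f_strong y0_in lambda0_gt0 gplus_ge1 gminus_gt1
      (sR k.+1) (ik : (i < k.+1)%N).
    by rewrite subr_ge0 ltW//= gerBl sqrtr_ge0.
  have := gap_ge0 y0d y0r; have := ler_wpM2l D0 rb.
  by rewrite /M; lra.
apply: (@in_boxW _ _ a1 b1); rewrite ?ge_min ?le_max ?lexx ?orbT//.
apply: h1 => //; apply: le_trans (E _ xd xr); rewrite /energy.
have g0 := gap_ge0 (Omega_dom yO) yr.
have DD : 0 <= D xstar (st_z (s k)) by exact: Dge0.
have := mulr_ge0 w0 g0; have := mulr_ge0 (mulr_ge0 (ltW mu_gt0) w0) DD.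
by rewrite thE; lra.
Qed.

(** By [tr_descent_Phi], applied at the minimizer, a proximal point that passes
    the descent test lies in a sublevel set of [Phi]; its level is the same for
    all trials because the trial points [x] stay in a box. *)
Lemma trial_box a0 b0 lmin : 0 < a0 -> 0 < lmin ->
  (forall k, in_box a0 b0 (st_y (s k)) /\ in_box a0 b0 (st_z (s k))) ->
  exists a b, 0 < a /\ forall k l kappa yh, lmin <= l ->
    tr_continues psi f rho mu (s k) l kappa yh ->
    tr_descent psi f mu (s k) l kappa yh -> in_box a b yh.
Proof.
move=> a00 lmin0 hb; have xp := proj1 (Omega_burgP _) xO.
pose B := \sum_(j < n) (xstar 0 j / a0 + b0 / xstar 0 j).
have [a [b [ap hab]]] := Phi_sublevel_box (rPhi xstar + lmin^-1 * B).
exists a, b; split => // k l kappa yh ll c d.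
have [sF _ _] := sI k; have l0 : 0 < l by apply: lt_le_trans ll.
have [kl yB _] := c.
have txO := tr_x_Omega psi_legendre mu_gt0 sF l0 kl.
have [yhO yhr] := bpg_Omega psi_legendre rho_proper rho_convex Omega_dom_rho
  l0 txO yB.
apply: hab => //; apply: le_trans (tr_descent_Phi sF l0 c xO xr d) _.
rewrite lerD2l; have txb := tr_x_box sF l0 c (proj1 (hb k)) (proj2 (hb k)).
apply: ler_pM; [by rewrite invr_ge0 ltW|exact: Dge0|by rewrite lef_pV2|].
rewrite rbregman_burg//; apply: ler_sum => j _.
have /andP[xa xb] := txb j; have tp := lt_le_trans a00 xa.
apply: le_trans (burg_kernel_upper (divr_gt0 (xp j) tp)) _.
rewrite invf_div; apply: lerD; last by rewrite ler_pM2r// invr_gt0.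
by rewrite ler_pM2l// lef_pV2.
Qed.

Lemma run_kappa_le : exists lmin K, [/\ 0 < lmin, 0 < K &
  forall k, [/\ lmin <= st_lambda (s k), 0 < st_kappa (s k) &
    st_kappa (s k) <= K]].
Proof.
have gm0 : 0 < gminus by apply: lt_trans gminus_gt1.
pose lmin := Num.min lambda0 (gminus * L)^-1.
have lmin0 : 0 < lmin by rewrite lt_min lambda0_gt0 invr_gt0 mulr_gt0.
have lminL : lmin * gminus * L <= 1.
  by rewrite -mulrA -ler_pdivlMr ?mulr_gt0// mul1r ge_min lexx orbT.
have [a1 [b1 [a10 h1]]] := run_box.
have [a2 [b2 [a20 h2]]] := trial_box a10 lmin0 h1.
pose a := Num.min a1 a2; pose b := Num.max b1 b2.
have a0 : 0 < a by rewrite lt_min a10.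
have [aa1 aa2] : a <= a1 /\ a <= a2 by rewrite !ge_min !lexx orbT.
have [bb1 bb2] : b1 <= b /\ b2 <= b by rewrite !le_max !lexx orbT.
pose k1 := 8 * (b / a + 1) ^+ 2; pose k2 := 128 * (b / a + 1) ^+ 2.
pose k3 := 16 * (b / a) ^+ 2 * (b / a + 1).
pose kbar := Num.max (k1 / (mu * lmin)) (Num.max k2 k3).
pose lmax := Num.max lambda0 mu^-1.
have lmax0 : 0 < lmax by rewrite lt_max lambda0_gt0.
pose K := Num.max kappa0
  (Num.max (gkappa * kbar) (gkappa * (2 * mu * (gplus * lmax)))).
have K0 : 0 < K by rewrite lt_max kappa0_gt0.
have gp0 : 0 < gplus by apply: lt_le_trans gplus_ge1.
exists lmin, K; split => // k.
suff [h1' h2' h3' h4'] : [/\ lmin <= st_lambda (s k), st_lambda (s k) <= lmax,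
    0 < st_kappa (s k) & st_kappa (s k) <= K] by [].
elim: k => [|k [IH1 IH2 IH3 IH4]].
  rewrite (proj1 (sR 0%N)) /=; split => //.
  - by rewrite ge_min lexx.
  - by rewrite le_max lexx.
  - by rewrite le_max lexx.
have [sF l0 _] := sI k.
have pass l kk yh : lmin <= l -> tr_continues psi f rho mu (s k) l kk yh ->
    tr_descent psi f mu (s k) l kk yh -> kbar <= kk ->
    tr_dual psi mu (s k) l kk yh /\ tr_gap psi f mu (s k) l kk yh.
  move=> ll c d; rewrite !ge_max => /and3P[kk1 kk2 kk3].
  have lp := lt_le_trans lmin0 ll.
  apply: (burg_trial sF lp c a0 _ _ _ d _ kk2 kk3).
  - exact: in_boxW aa1 bb1 (proj1 (h1 k)).
  - exact: in_boxW aa1 bb1 (proj2 (h1 k)).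
  - exact: in_boxW aa2 bb2 (h2 _ _ _ _ ll c d).
  have kp : 0 <= kk.
    apply: le_trans kk1; apply: divr_ge0; last by rewrite ltW// mulr_gt0.
    by rewrite /k1 mulr_ge0 ?sqr_ge0.
  apply: (@le_trans _ _ (kk * (mu * lmin))).
    by rewrite -ler_pdivrMr// mulr_gt0.
  by rewrite -mulrA; apply: ler_wpM2l => //; rewrite ler_pM2l.
have [_ srch] := proj2 (sR k.+1) k (ltnSn k).
have [kl _ _] := run_step psi_legendre f_proper dom_psi_f rho_proper rho_convex
  Omega_dom_rho mu_gt0 f_strong y0_in lambda0_gt0 gplus_ge1 gminus_gt1
  (sR k.+1) (ltnSn k).
have [_ l0' _] := sI k.+1.
have [] := search_kappa_le lmin0 lminL sF pass _ _ srch (lmax := gplus * lmax) (K := K).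
- by rewrite !le_max lexx ?orbT.
- by rewrite !le_max lexx ?orbT.
- rewrite (le_trans IH1) ?ler_peMl// ?(ltW l0)//=.
  by rewrite ler_pM2l.
- apply: le_trans IH4; rewrite ler_pdivrMr// ler_peMr// ltW//.
move=> r1 r2 r3; split => //; last by apply: le_lt_trans kl; rewrite !mulr_ge0 ?ltW.
rewrite le_max; apply/orP; right.
by rewrite -[leRHS]mul1r ler_pdivlMr.
Qed.

End run.

Theorem burg_linear_convergence (s : nat -> @state R n) :
  (forall N, is_run N s) ->
  has_ubound (range (fun k => st_kappa (s k))) /\
  linear_convergence
    (fun k => Phi f rho (st_y (s k)) - Phi_star psi f rho)%E.
Proof.
move=> sR; have [xstar xmin xO] := Phi_argmin.
have [lmin [K [lmin0 K0 H]]] := run_kappa_le sR xmin xO.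
split; first by exists K => _ [k _ <-]; have [] := H k.
pose q := Num.sqrt (2 * mu * lmin / K).
apply: (linear_rate psi_legendre f_proper dom_psi_f rho_proper rho_convex
  Omega_dom_rho mu_gt0 f_strong y0_in lambda0_gt0 gplus_ge1 gminus_gt1
  xmin (Omega_dom xO) sR (qmin := q)).
  by rewrite sqrtr_gt0 divr_gt0// !mulr_gt0.
move=> k _; have [lk kp kK] := H k; rewrite ler_wsqrtr//.
apply: ler_pM; rewrite ?invr_ge0 ?(ltW K0)//.
- by rewrite !mulr_ge0// ltW.
- by rewrite ler_pM2l// mulr_gt0.
- by rewrite lef_pV2.
Qed.

End burg_run.

Theorem mainTheorem2 (R : realType) (n : nat) (psi f rho : 'rV[R]_n -> \bar R)
    (L mu lambda0 kappa0 gplus gminus gkappa : R) (y0 : 'rV[R]_n)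
    (psi_legendre : legendre psi)
    (f_proper : proper_fun f)
    (f_lsc : lower_semicontinuous f)
    (dom_psi_f : dom psi `<=` dom f)
    (f_diff : forall x, Omega psi x -> edifferentiable f x)
    (f_C1 : forall x, Omega psi x -> {for x, continuous (grad f)})
    (rho_proper : proper_fun rho)
    (rho_lsc : lower_semicontinuous rho)
    (rho_convex : econvex rho)
    (Omega_dom_rho : (Omega psi `&` dom rho) !=set0)
    (L_gt0 : 0 < L)
    (f_smooth : forall u v : 'rV[R]_n, Omega psi u -> Omega psi v ->
      (bregman f u v <= L%:E * bregman psi u v)%E)
    (Phi_bounded : (-oo < Phi_star psi f rho)%E)
    (solvable : forall x (lambda : R), Omega psi x -> 0 < lambda ->
      bpg psi f rho lambda x !=set0)
    (mu_gt0 : 0 < mu)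
    (f_strong : forall u v : 'rV[R]_n, closure (Omega psi) u -> Omega psi v ->
      (mu%:E * bregman psi u v <= bregman f u v)%E)
    (y0_in : (Omega psi `&` dom rho) y0)
    (lambda0_gt0 : 0 < lambda0)
    (kappa0_gt0 : 0 < kappa0)
    (gplus_ge1 : 1 <= gplus)
    (gminus_gt1 : 1 < gminus)
    (gkappa_gt1 : 1 < gkappa) :
  let is_run := run psi f rho mu gplus gminus gkappa y0 lambda0 kappa0 in
  let bound s (N : nat) u :=
    (bregman psi u (st_z (s 0%N)) *
     ((st_omega (s 1%N))^-1 *
      \prod_(2 <= k < N.+1) (1 - rate mu (s k)))%:E)%E in
  let gap s (k : nat) := (Phi f rho (st_y (s k)) - Phi_star psi f rho)%E in
  [/\ forall s N, (1 <= N)%N -> is_run N s ->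
        forall u, (closure (Omega psi) `&` dom (Phi f rho) `&` dom psi) u ->
        (Phi f rho (st_y (s N)) - Phi f rho u <= bound s N u)%E,
      forall xstar, argmin (closure (Omega psi)) (Phi f rho) xstar ->
        dom psi xstar ->
        (forall s N, (1 <= N)%N -> is_run N s ->
          (gap s N <= bound s N xstar)%E) /\
        (forall s, (forall N, is_run N s) ->
          forall qmin : R, 0 < qmin ->
          (forall k, (1 <= k)%N -> qmin <= rate mu (s k)) ->
          linear_convergence (gap s)) &
      psi = burg -> forall s, (forall N, is_run N s) ->
        has_ubound (range (fun k => st_kappa (s k))) /\
        linear_convergence (gap s)].
Proof.
move=> is_run bound gap.
have psi_proper : proper_fun psi by case: psi_legendre.
split.
- move=> s N N1 sR u [[_ uPhi] ud].
  exact: (estimate psi_legendre f_proper dom_psi_f rho_proper rho_convex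
    Omega_dom_rho mu_gt0 f_strong y0_in lambda0_gt0 gplus_ge1 gminus_gt1
    N1 sR ud (dom_Phi_rho f_proper rho_proper uPhi)).
- move=> xstar xmin xd.
  have xr := argmin_dom_rho f_proper dom_psi_f rho_proper y0_in xmin.
  split=> [s N N1 sR|s sR qmin q0 qr].
    rewrite /gap (Phi_star_argmin f_proper dom_psi_f rho_proper y0_in xmin xd).
    rewrite -(PhiE f_proper dom_psi_f rho_proper xd xr).
    exact: (estimate psi_legendre f_proper dom_psi_f rho_proper rho_convex
      Omega_dom_rho mu_gt0 f_strong y0_in lambda0_gt0 gplus_ge1 gminus_gt1
      N1 sR xd xr).
  exact: (linear_rate psi_legendre f_proper dom_psi_f rho_proper rho_convex
    Omega_dom_rho mu_gt0 f_strong y0_in lambda0_gt0 gplus_ge1 gminus_gt1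
    xmin xd sR q0 qr).
- move=> psiE s sR; subst psi.
  exact: (burg_linear_convergence psi_legendre f_proper f_lsc dom_psi_f
    rho_proper rho_lsc rho_convex Omega_dom_rho L_gt0 f_smooth solvable mu_gt0
    f_strong y0_in lambda0_gt0 kappa0_gt0 gplus_ge1 gminus_gt1 gkappa_gt1 sR).
Qed.
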